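(* Let $f:(0,\infty)\to\mathbb{R}$ be a locally integrable function whose Laplace transform $F(z)=\int_0^\infty e^{-zx}f(x)\,dx$ exists (is finite) for all $z>0$, let $f_n$ ($n\ge 1$) be the Gaver-Stehfest approximations of $f$, and let $x>0$. If $$f(x+v)-f(x)=O(|v|^{\alpha})$$ for some $\alpha>0$ and all $v$ in some neighborhood of $0$, then $f_n(x)\to f(x)$ as $n\to+\infty$.
   Context: Integrals are Lebesgue integrals. For a function $f$ with Laplace transform $F$, the Gaver-Stehfest approximations are $$f_n(x):=\frac{\ln 2}{x}\sum_{k=1}^{2n}a_k(n)\,F\left(\frac{k\ln 2}{x}\right),\qquad n\ge 1,\ x>0,$$ where $$a_k(n):=\frac{(-1)^{n+k}}{n!}\sum_{j=[(k+1)/2]}^{\min(k,n)}j^{n+1}\binom{n}{j}\binom{2j}{j}\binom{j}{k-j},\qquad n\ge 1,\ 1\le k\le 2n,$$ and $[\cdot]$ denotes the integer part. The hypothesis means that there are $K,\delta>0$ with $|f(x+v)-f(x)|\le K|v|^\alpha$ for all $|v|<\delta$. *)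

(* Defs.v *)
From HB Require Import structures.
From mathcomp Require Import all_boot all_order all_algebra.
From mathcomp Require Import all_classical all_reals all_analysis.

Set Implicit Arguments.
Unset Strict Implicit.
Unset Printing Implicit Defensive.

Import Order.TTheory GRing.Theory Num.Theory.
Import numFieldNormedType.Exports.

Local Open Scope classical_set_scope.
Local Open Scope ring_scope.

(* The completed measure is used so that "measurable" means Lebesgue (rather
   than Borel) measurable; its sigma-algebra consists of the Caratheodory
   measurable sets, the carrier being convertible to [R]. *)
Notation leb R := (@completed_lebesgue_measure R).

(* Functions on (0, +oo) are represented by total functions [R -> R] of which
   only the values on `]0, +oo[ are used. *)

Definition locally_integrable_pos (R : realType) (f : R -> R) : Prop :=
  forall K : set R, K `<=` `]0, +oo[ -> compact K ->
    (leb R).-integrable K (fun t => (f t)%:E).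

Definition laplace_exists (R : realType) (f : R -> R) (z : R) : Prop :=
  (leb R).-integrable `]0, +oo[ (fun t => (expR (- (z * t)) * f t)%:E).

Definition laplace (R : realType) (f : R -> R) (z : R) : R :=
  \int[leb R]_(t in `]0, +oo[) (expR (- (z * t)) * f t).

Definition gs_coef (R : realType) (n k : nat) : R :=
  (-1) ^+ (n + k) / n`!%:R *
  \sum_((k.+1)./2 <= j < (minn k n).+1)
    j%:R ^+ n.+1 * 'C(n, j)%:R * 'C(j.*2, j)%:R * 'C(j, k - j)%:R.

Definition gaver_stehfest (R : realType) (f : R -> R) (n : nat) (x : R) : R :=
  ln 2 / x *
  \sum_(1 <= k < (n.*2).+1) gs_coef R n k * laplace f (k%:R * ln 2 / x).

(* Main.v *)
(* Put c = ln 2 / x and w = exp(-c t).  Then f_n(x) is the integral of f against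
   c k_n(4 w (1 - w)), where k_n(z) = M_n[j C(2j,j) (z/4)^j] and
     M_n[F] = sum_j (-1)^(n+j) C(n,j) j^n / n! F(j),   M_n[1] = 1.
   This kernel has mass 1 (a beta-integral identity), and z = 4 w (1 - w) equals
   1 exactly at t = x.  Dominated convergence applied to k_n (f(t) - f(x)) needs
   two estimates for k_n.
   (1) |k_n(z)| <= (3/2) / sqrt(1 - z).  With R_k(j) = C(2j,j+k) / C(2j,j), the
   numbers p_n(k) = M_n[R_k - R_(k+1)] form a probability distribution, and
     sin X * M_n[(2 cos X)^(2j) / C(2j,j)] = sum_k p_n(k) sin((2k+1) X),
   so the left-hand side is at most 1 in absolute value.  Going from the
   coefficients 4^j / C(2j,j) to j C(2j,j) / 4^j multiplies them by
   j (C(2j,j) / 4^j)^2, a constant times a limit of products of factors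
   1 - 1/(2j+2l+1)^2, and each factor acts boundedly for the sup norm on [0, y].
   (2) k_n(z)^2 (1 - z)^5 <= B z / n.  The recursion
   (j - n - 1) lambda_(n+1)(j) = j lambda_n(j) for the weights of M_n turns into
   k_n' = k_(n+1)' - (n+1) k_(n+1) / z, from which the energies
   int_0^1 (1-z)^5 k_n'^2 are almost nonincreasing in n, with a gain that
   dominates n^2 int_0^1 (1-z)^5 (k_n/z)^2.
   From (1) and (2), |k_n| <= C sqrt w / |1 - 2 w|, which is integrable against
   |f(t) - f(x)| by the Hoelder condition at x, and k_n -> 0 off t = x. *)
Require Import Defs.
From mathcomp Require Import all_boot all_order all_algebra.
From mathcomp Require Import polyrcf.
From mathcomp Require Import all_classical all_reals all_analysis.
From mathcomp Require Import measurable_realfun.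
From mathcomp Require Import ring lra zify.
Set Implicit Arguments.
Unset Strict Implicit.
Unset Printing Implicit Defensive.
Import Order.TTheory GRing.Theory Num.Theory.
Import numFieldNormedType.Exports.
Local Open Scope classical_set_scope.
Local Open Scope ring_scope.

(** * The weights of the Gaver-Stehfest average *)

(** For n > 0 these are the Richardson extrapolation weights: [gs_mean n F] is the value at 0 of the
    polynomial of degree below n in 1/j that interpolates F(1), ..., F(n). Equivalently, it is the
    n-th difference at 0 of j^n F(j), divided by n!. *)
Definition gs_weight (R : realFieldType) (n j : nat) : R :=
  (-1) ^+ (n + j) * 'C(n, j)%:R * j%:R ^+ n / n`!%:R.

Definition gs_mean (R : realFieldType) (n : nat) (F : nat -> R) : R :=
  \sum_(j < n.+1) gs_weight R n j * F j.

Lemma fact_neq0 (R : realFieldType) n : n`!%:R != 0 :> R.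
Proof. by rewrite pnatr_eq0 -lt0n fact_gt0. Qed.

Lemma gs_weight0 (R : realFieldType) n : (0 < n)%N -> gs_weight R n 0 = 0.
Proof. by case: n => // n _; rewrite /gs_weight expr0n /= mulr0 mul0r. Qed.

Lemma gs_weight_gt (R : realFieldType) n j : (n < j)%N -> gs_weight R n j = 0.
Proof. by move=> nj; rewrite /gs_weight bin_small// mulr0 !mul0r. Qed.

(** Kept free of division so that it holds for every j, including j > n. It is the source of all
    recursions in n below. *)
Lemma gs_weightS (R : realFieldType) n j :
  (j%:R - n.+1%:R) * gs_weight R n.+1 j = j%:R * gs_weight R n j.
Proof.
have [nj|jn] := ltnP n.+1 j; first by rewrite !gs_weight_gt ?mulr0// ltnW.
have E : (n.+1 - j)%:R * 'C(n.+1, j)%:R = n.+1%:R * 'C(n, j)%:R :> R.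
  by rewrite -!natrM; congr (_%:R); rewrite mul_bin_down mulnC.
rewrite natrB// in E.
rewrite /gs_weight factS natrM invfM addSn exprS mulN1r exprSr.
transitivity ((-1) ^+ (n + j) * j%:R ^+ n * j%:R / (n.+1%:R * n`!%:R)
  * ((n.+1%:R - j%:R) * 'C(n.+1, j)%:R) : R).
  field; rewrite fact_neq0/=; apply/eqP; have : (0:R) <= n%:R := ler0n _ _; lra.
rewrite E; field.
rewrite fact_neq0/=; apply/eqP; have : (0:R) <= n%:R := ler0n _ _; lra.
Qed.

Lemma gs_mean_widen (R : realFieldType) n N (F : nat -> R) : (n <= N)%N ->
  gs_mean n F = \sum_(j < N.+1) gs_weight R n j * F j.
Proof.
move=> nN; rewrite /gs_mean (big_ord_widen N.+1 (fun j => gs_weight R n j * F j))//.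
rewrite big_mkcond; apply: eq_bigr => j _; case: ifPn => //.
by rewrite -leqNgt => ?; rewrite gs_weight_gt ?mul0r.
Qed.

Lemma eq_gs_mean (R : realFieldType) n (F G : nat -> R) :
  (forall j, (0 < j <= n)%N -> F j = G j) -> (0 < n)%N ->
  gs_mean n F = gs_mean n G.
Proof.
move=> FG n0; apply: eq_bigr => -[[|j] jn] _ /=; first by rewrite !gs_weight0 ?mul0r.
by rewrite FG//.
Qed.

Lemma gs_meanB (R : realFieldType) n (F G : nat -> R) :
  gs_mean n (fun j => F j - G j) = gs_mean n F - gs_mean n G.
Proof. by rewrite /gs_mean -sumrB; apply: eq_bigr => j _; rewrite mulrBr. Qed.

Lemma gs_meanD (R : realFieldType) n (F G : nat -> R) :
  gs_mean n (fun j => F j + G j) = gs_mean n F + gs_mean n G.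
Proof. by rewrite /gs_mean -big_split; apply: eq_bigr => j _; rewrite mulrDr. Qed.

Lemma gs_meanZ (R : realFieldType) n a (F : nat -> R) :
  gs_mean n (fun j => a * F j) = a * gs_mean n F.
Proof. by rewrite /gs_mean mulr_sumr; apply: eq_bigr => j _; rewrite mulrCA. Qed.

(** By [gs_weightS] consecutive weights differ by (n+1)/j times the weight of order n+1. At j = 0,
    where [F j / j%:R] takes its default value, the weight vanishes. *)
Lemma gs_meanS (R : realFieldType) n (F : nat -> R) : (0 < n)%N ->
  gs_mean n.+1 F - gs_mean n F = n.+1%:R * gs_mean n.+1 (fun j => F j / j%:R).
Proof.
move=> n0; rewrite (gs_mean_widen F (leqnSn n)) /gs_mean -sumrB mulr_sumr.
apply: eq_bigr => -[[|j] jn] _ /=; first by rewrite !gs_weight0// !mul0r subrr mulr0.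
have j0 : j.+1%:R != 0 :> R by rewrite pnatr_eq0.
apply: (mulfI j0); rewrite mulrBr mulrA [in X in _ - X]mulrA -gs_weightS.
by field; rewrite -natr1 in j0 *; rewrite ?[1 + _]addrC.
Qed.

(** This is the n-th difference of j^m at 0. Absorbing j into the binomial coefficient lowers n;
    after expanding (i+1)^m only the top power can survive. *)
Lemma alt_sum_bin_expn (R : realFieldType) n m : (m <= n)%N ->
  \sum_(j < n.+1) (-1) ^+ (n + j) * 'C(n, j)%:R * j%:R ^+ m
  = (if m == n then n`!%:R else 0) :> R.
Proof.
elim: n m => [|n IH] m.
  by rewrite leqn0 => /eqP->; rewrite big_ord1 /= !expr0 bin0 !mulr1.
case: m => [_|m].
  have := exprDn (-1 : R) 1 n.+1; rewrite addNr expr0n/= => E0.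
  rewrite /=; refine (etrans _ (esym E0)); apply: eq_bigr => j _.
  rewrite expr0 expr1n !mulr1 mulr_natr; congr (_ *+ _).
  by rewrite -signr_odd -[RHS]signr_odd oddD oddB// -ltnS.
rewrite ltnS eqSS => mn; rewrite big_ord_recl/= expr0n/= mulr0 add0r.
transitivity (n.+1%:R * \sum_(i < n.+1) (-1) ^+ (n + i) * 'C(n, i)%:R * i.+1%:R ^+ m : R).
  rewrite mulr_sumr; apply: eq_bigr => i _; rewrite /bump/= add1n addSn addnS.
  have E : i.+1%:R * 'C(n.+1, i.+1)%:R = n.+1%:R * 'C(n, i)%:R :> R.
    by rewrite -!natrM mul_bin_diag.
  rewrite 2!exprS !mulN1r opprK [_ ^+ m.+1]exprS mulrA -[_ * _ * i.+1%:R]mulrA.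
  by rewrite ['C(_, _)%:R * _]mulrC E; ring.
under eq_bigr => i _ do rewrite -natr1 exprDn mulr_sumr.
rewrite exchange_big/=.
under eq_bigr => k _.
  under eq_bigr do rewrite expr1n mulr1 -[_ *+ 'C(m, k)]mulr_natr mulrA.
  rewrite -mulr_suml IH; last by rewrite (leq_trans _ mn)// leq_subr.
  over.
rewrite big_ord_recl/= subn0 bin0 mulr1 big1 ?addr0; last first.
  move=> i _; rewrite /bump/= add1n; case: eqP => [|_]; last by rewrite mul0r.
  by have := ltn_ord i; lia.
by case: eqP => _; rewrite ?mulr0// factS natrM.
Qed.

Lemma gs_mean1 (R : realFieldType) n : gs_mean n (fun=> 1) = 1 :> R.
Proof.
rewrite /gs_mean; under eq_bigr do rewrite mulr1 /gs_weight.
by rewrite -mulr_suml alt_sum_bin_expn// eqxx divff// fact_neq0.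
Qed.

(** * The probability distribution behind the kernel *)

Definition bin_ratio (R : realFieldType) (k j : nat) : R :=
  'C(j.*2, j + k)%:R / 'C(j.*2, j)%:R.

Lemma bin2_neq0 (R : realFieldType) j : 'C(j.*2, j)%:R != 0 :> R.
Proof. by rewrite pnatr_eq0 -lt0n bin_gt0 -addnn leq_addr. Qed.

Lemma bin_ratio_gt (R : realFieldType) k j : (j < k)%N -> bin_ratio R k j = 0.
Proof. by move=> jk; rewrite /bin_ratio bin_small ?mul0r// -addnn ltn_add2l. Qed.

Lemma bin_ratio_step (R : realFieldType) k j :
  (j%:R + k.+1%:R) * bin_ratio R k.+1 j = (j%:R - k%:R) * bin_ratio R k j.
Proof.
have [jk|kj] := ltnP j k; first by rewrite !bin_ratio_gt ?mulr0// ltnW.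
rewrite /bin_ratio !mulrA -natrD -natrB// -!natrM; congr (_%:R / _).
rewrite addnS mul_bin_left; congr (_ * _)%N; lia.
Qed.

(** Once divided by j, the right-hand side consists of terms R_k / j, which are what [gs_meanS]
    averages. *)
Lemma bin_ratio_sub (R : realFieldType) k j :
  j%:R * (bin_ratio R k j - bin_ratio R k.+1 j)
  = k%:R * bin_ratio R k j + k.+1%:R * bin_ratio R k.+1 j.
Proof. have := bin_ratio_step R k j; rewrite -natr1; lra. Qed.

Definition gs_law (R : realFieldType) (n k : nat) : R :=
  gs_mean n (fun j => bin_ratio R k j - bin_ratio R k.+1 j).

Lemma gs_law_ge0 (R : realFieldType) n k : (0 < n)%N -> 0 <= gs_law R n k.
Proof.
case: n => // n _; elim: n k => [|n IH] k.
  have w11 : gs_weight R 1 1 = 1.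
    by rewrite /gs_weight addn1 sqrrN !expr1n binn !mul1r invr1.
  rewrite /gs_law /gs_mean !big_ord_recl big_ord0 gs_weight0//= mul0r add0r addr0.
  rewrite w11 mul1r /bin_ratio subr_ge0 ler_pM2r ?invr_gt0 ?ltr0n//.
  by rewrite ler_nat; case: k => [|[|k]].
(* The recursions E1 and E2 determine (gs_law n.+2, G) from gs_law n.+1 with
   nonnegative coefficients in the range i <= n.+2 where gs_law lives. *)
pose G i := gs_mean n.+2 (bin_ratio R i) - gs_mean n.+1 (bin_ratio R i).
have lawE m i : gs_law R m i = gs_mean m (bin_ratio R i) - gs_mean m (bin_ratio R i.+1).
  by rewrite /gs_law gs_meanB.
have GS i : G i.+1 = G i + gs_law R n.+1 i - gs_law R n.+2 i.
  by rewrite /G !lawE; ring.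
(* [gs_meanS] turns G into averages of R_i / j, and [bin_ratio_sub] recombines these into R_i -
   R_(i+1). *)
have E i : n.+2%:R * gs_law R n.+2 i = i%:R * G i + i.+1%:R * G i.+1.
  rewrite /G !gs_meanS// mulrCA [in X in _ = _ + X]mulrCA -mulrDr; congr (_ * _).
  rewrite -!gs_meanZ -gs_meanD; apply: eq_gs_mean => // j /andP[j0 _].
  have j0' : j%:R != 0 :> R by rewrite pnatr_eq0 -lt0n.
  by apply: (mulfI j0'); rewrite bin_ratio_sub; field.
have E1 i : (n.+2%:R + i.+1%:R) * gs_law R n.+2 i
    = i.*2.+1%:R * G i + i.+1%:R * gs_law R n.+1 i.
  by have := E i; rewrite GS -!natr1 -muln2 natrM; lra.
have E2 i : (n.+2%:R + i.+1%:R) * G i.+1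
    = n.+2%:R * gs_law R n.+1 i + (n.+2%:R - i%:R) * G i.
  by rewrite GS mulrBr E1 -!natr1 -muln2 natrM; ring.
have G0 : G 0%N = 0.
  have R0 m : (0 < m)%N -> gs_mean m (bin_ratio R 0) = 1.
    move=> m0; rewrite -[RHS](gs_mean1 R m); apply: eq_gs_mean => // j _.
    by rewrite /bin_ratio addn0 divff// bin2_neq0.
  by rewrite /G !R0// subrr.
have G_ge0 i : 0 <= G i.
  have [in2|] := leqP i n.+2; last first.
    by move=> ni; rewrite /G /gs_mean !big1 ?subrr// => j _;
      rewrite bin_ratio_gt ?mulr0//; have := ltn_ord j; lia.
  elim: i in2 => [|i IHi] in2; first by rewrite G0.
  have p0 : (0 : R) < n.+2%:R + i.+1%:R by rewrite -natrD ltr0n.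
  rewrite -(pmulr_rge0 _ p0) E2 addr_ge0// mulr_ge0//.
    by rewrite subr_ge0 ler_nat ltnW.
  by rewrite IHi// ltnW.
have p0 : (0 : R) < n.+2%:R + k.+1%:R by rewrite -natrD ltr0n.
by rewrite -(pmulr_rge0 _ p0) E1 addr_ge0// mulr_ge0.
Qed.

(** The sum telescopes from M_n[R_0] = M_n[1] = 1 down to M_n[R_(N+1)] = 0. *)
Lemma sum_gs_law (R : realFieldType) n N : (0 < n)%N -> (n <= N)%N ->
  \sum_(k < N.+1) gs_law R n k = 1.
Proof.
move=> n0 nN; rewrite /gs_law.
under eq_bigr do rewrite gs_meanB.
rewrite -(big_mkord xpredT (fun k => gs_mean n (bin_ratio R k) - gs_mean n (bin_ratio R k.+1))).
under eq_bigr do rewrite -opprB.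
rewrite sumrN telescope_sumr// opprB -[RHS]subr0; congr (_ - _).
  rewrite -[RHS](gs_mean1 R n); apply: eq_gs_mean => // j _.
  by rewrite /bin_ratio addn0 divff// bin2_neq0.
rewrite /gs_mean big1// => j _; rewrite bin_ratio_gt ?mulr0//.
by rewrite (leq_trans (ltn_ord j)).
Qed.

(** * Coefficient multipliers of polynomials *)

(** The substitute for integration in the polynomial estimates: an inequality between integrals is
    obtained as monotonicity of a difference of primitives. *)
Lemma horner_homo (R : rcfType) (p : {poly R}) (a b : R) : a <= b ->
  (forall x, a <= x <= b -> 0 <= p^`().[x]) -> p.[a] <= p.[b].
Proof.
rewrite le_eqVlt => /predU1P[->//|ab] p0.
have [c cab E] := poly_mvt p ab.
rewrite -subr_ge0 E mulr_ge0 ?subr_ge0 ?(ltW ab)//.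
by apply: p0; move: cab; rewrite in_itv/= => /andP[/ltW-> /ltW->].
Qed.

(** For m > 0 and y > 0 its value at y is y^(-m) times the integral of t^(m-1) p(t) over [0, y],
    that is, 1/m times a weighted average of p. *)
Definition coef_shift_div (R : rcfType) (m : nat) (p : {poly R}) : {poly R} :=
  \poly_(i < size p) (p`_i / (i + m)%:R).

Lemma coef_coef_shift_div (R : rcfType) m (p : {poly R}) i :
  (coef_shift_div m p)`_i = p`_i / (i + m)%:R.
Proof.
by rewrite coef_poly; case: ltnP => // ?; rewrite nth_default// mul0r.
Qed.

Lemma deriv_coef_shift_div (R : rcfType) m (p : {poly R}) :
  ('X^(m.+1) * coef_shift_div m.+1 p)^`() = 'X^m * p.
Proof.
apply/polyP => i; rewrite coef_deriv !coefXnM coef_coef_shift_div ltnS.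
case: ltnP => mi; first by rewrite mul0rn.
have -> : (i.+1 - m.+1 + m.+1 = i.+1)%N by lia.
by rewrite subSS -[LHS]mulr_natr divfK// pnatr_eq0.
Qed.

(** The difference q of the two sides, multiplied by x^(m+1), has derivative x^m (M - p(x)) >= 0.
    The point y = 0 is treated apart because that factor cannot be cancelled there. *)
Lemma horner_coef_shift_div_le (R : rcfType) m (p : {poly R}) (M y : R) :
  (forall x, 0 <= x <= y -> p.[x] <= M) -> 0 <= y ->
  (coef_shift_div m.+1 p).[y] <= M / m.+1%:R.
Proof.
move=> pM y0; have m0 : (0 : R) < m.+1%:R by rewrite ltr0n.
move: y0; rewrite le_eqVlt => /predU1P[y0|y0].
  rewrite -y0 horner_coef0 coef_coef_shift_div add0n ler_pM2r ?invr_gt0//.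
  by rewrite -horner_coef0 pM// y0 lexx.
pose q := (M / m.+1%:R) *: 'X^(m.+1) - 'X^(m.+1) * coef_shift_div m.+1 p.
have : q.[0] <= q.[y].
  apply: horner_homo (ltW y0) _ => x xy; have /andP[x0 _] := xy.
  rewrite derivB deriv_coef_shift_div derivZ derivXn !hornerE hornerMn hornerXn.
  have -> : M / m.+1%:R * (x ^+ m *+ m.+1) = x ^+ m * M.
    by rewrite -[X in _ * X]mulr_natr mulrCA divfK ?lt0r_neq0.
  rewrite -mulrBr.
  by rewrite mulr_ge0 ?exprn_ge0// subr_ge0 pM.
rewrite /q !hornerE ?hornerXn expr0n/= mul0r mulr0 subr0.
by rewrite [X in X - _]mulrC -mulrBr pmulr_rge0 ?exprn_gt0// subr_ge0.
Qed.

Lemma norm_horner_coef_shift_div (R : rcfType) m (p : {poly R}) (M y : R) :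
  (forall x, 0 <= x <= y -> `|p.[x]| <= M) ->
  forall x, 0 <= x <= y -> `|(coef_shift_div m.+1 p).[x]| <= M / m.+1%:R.
Proof.
move=> pM x /andP[x0 xy]; rewrite ler_norml lerNl.
have pM' t : 0 <= t <= x -> `|p.[t]| <= M.
  by move=> /andP[t0 tx]; rewrite pM// t0 (le_trans tx).
rewrite !horner_coef_shift_div_le// => [|t tx]; last exact: le_trans (ler_norm _) (pM' _ tx).
rewrite andbT; have -> : - (coef_shift_div m.+1 p).[x] = (coef_shift_div m.+1 (- p)).[x].
  rewrite -hornerN; congr (_.[_]); apply/polyP => i.
  by rewrite coefN !coef_coef_shift_div coefN mulNr.
apply: horner_coef_shift_div_le => // t tx.
by rewrite hornerN (le_trans (ler_norm _))// normrN pM'.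
Qed.

(* Multiplies the coefficient of 'X^i by the product over l < I of
   1 - 1/(i+2l+1)^2, as a composition of operators bounded for the sup norm. *)
Fixpoint wallis_damp (R : rcfType) (I : nat) (p : {poly R}) : {poly R} :=
  if I is I'.+1 then
    let q := wallis_damp I' p in
    q - coef_shift_div (I'.*2.+1) (coef_shift_div (I'.*2.+1) q)
  else p.

Lemma coef_wallis_damp (R : rcfType) I (p : {poly R}) i :
  (wallis_damp I p)`_i = p`_i * \prod_(l < I) (1 - ((i + l.*2.+1)%:R ^+ 2)^-1).
Proof.
elim: I => [|I IH]; first by rewrite big_ord0 mulr1.
rewrite big_ord_recr/= coefB !coef_coef_shift_div IH expr2 invfM; ring.
Qed.

Lemma prod_wallis_le (R : rcfType) I :
  \prod_(l < I) (1 + (l.*2.+1%:R ^+ 2)^-1) <= 3 :> R.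
Proof.
(* The slack 1/(I+1) is what makes the induction close; it starts from the factor 2 = 3 - 1 at l =
   0. The infinite product is cosh(pi/2), about 2.51. *)
suff : \prod_(l < I.+1) (1 + (l.*2.+1%:R ^+ 2)^-1) <= 3 - I.+1%:R^-1 :> R.
  rewrite big_ord_recr/= => h; have i0 : (0 : R) < I.+1%:R^-1 by rewrite invr_gt0 ltr0n.
  have P0 : 0 <= \prod_(l < I) (1 + (l.*2.+1%:R ^+ 2)^-1) :> R.
    by apply: prodr_ge0 => l _; rewrite addr_ge0// invr_ge0 exprn_ge0.
  have : \prod_(l < I) (1 + (l.*2.+1%:R ^+ 2)^-1) * 1 <=
      \prod_(l < I) (1 + (l.*2.+1%:R ^+ 2)^-1) * (1 + (I.*2.+1%:R ^+ 2)^-1) :> R.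
    by rewrite ler_wpM2l// lerDl invr_ge0 exprn_ge0.
  rewrite mulr1 => h2; by apply: (le_trans h2); apply: (le_trans h); rewrite gerBl ltW.
elim: I => [|I IH]; first by rewrite big_ord1/= expr1n !invr1; lra.
rewrite big_ord_recr/=.
have k0 : (0 : R) < I.+1%:R by rewrite ltr0n.
have h0 : (0:R) <= 1 + (I.+1.*2.+1%:R ^+ 2)^-1 by rewrite addr_ge0// invr_ge0 exprn_ge0.
apply: (le_trans (ler_wpM2r h0 IH)).
rewrite -[I.+2%:R]natr1 -[I.+1.*2.+1%:R]natr1 -muln2 natrM.
move: k0; set k : R := I.+1%:R => k0.
have -> : (3 - k^-1) * (1 + ((k * 2 + 1) ^+ 2)^-1) =
   3 - (k + 1)^-1 - (k ^+ 2 + 2 * k + 2) / (k * (k + 1) * (k * 2 + 1) ^+ 2).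
  by field; rewrite ?mulf_neq0 ?expf_neq0 ?lt0r_neq0//; lra.
rewrite lerBlDr lerDl divr_ge0 ?mulr_ge0 ?exprn_ge0//; nra.
Qed.

Lemma norm_horner_wallis_damp (R : rcfType) I (p : {poly R}) (M y : R) :
  0 <= M -> (forall x, 0 <= x <= y -> `|p.[x]| <= M) ->
  forall x, 0 <= x <= y -> `|(wallis_damp I p).[x]| <= 3 * M.
Proof.
move=> M0 pM x xy.
apply: (@le_trans _ _ ((\prod_(l < I) (1 + (l.*2.+1%:R ^+ 2)^-1)) * M)); last first.
  by rewrite ler_wpM2r// prod_wallis_le.
elim: I x xy => [|I IH] x xy; first by rewrite big_ord0 mul1r/= pM.
rewrite big_ord_recr/= hornerD hornerN (le_trans (ler_normB _ _))//.
rewrite mulrAC mulrDr mulr1 lerD ?IH//.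
by rewrite expr2 invfM mulrA; apply: norm_horner_coef_shift_div xy;
  apply: norm_horner_coef_shift_div.
Qed.

(** * Squares of central binomial coefficients *)

(** The multiplier from 4^j / C(2j,j) to j C(2j,j) / 4^j. By Wallis it increases to 1/pi. *)
Definition central_sq (R : rcfType) (j : nat) : R :=
  j%:R * ('C(j.*2, j)%:R / 4 ^+ j) ^+ 2.

Lemma bin2S (R : rcfType) j :
  j.+1%:R * 'C(j.+1.*2, j.+1)%:R = 2 * j.*2.+1%:R * 'C(j.*2, j)%:R :> R.
Proof.
have E1 : (j.+1 * 'C(j.+1.*2, j.+1) = j.+1.*2 * 'C(j.*2.+1, j))%N.
  by rewrite -mul_bin_diag.
have E2 : (j.+1 * 'C(j.*2.+1, j) = j.*2.+1 * 'C(j.*2, j))%N.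
  have := mul_bin_down j.*2.+1 j; rewrite /= => ->.
  by congr (_ * _)%N; lia.
by rewrite -!natrM; congr (_%:R); rewrite E1; lia.
Qed.

(** The ratio of consecutive values is (2j+1)^2 / (4 j (j+1)), whose inverse is 1 - 1/(2j+1)^2. *)
Lemma central_sqS (R : rcfType) j : (0 < j)%N ->
  central_sq R j.+1 * (1 - (j.*2.+1%:R ^+ 2)^-1) = central_sq R j.
Proof.
move=> j0; have j0' : (0 : R) < j%:R by rewrite ltr0n.
have E := bin2S R j; have p4 : (4 : R) ^+ j != 0 by rewrite expf_neq0// pnatr_eq0.
have -> : central_sq R j.+1 = (j.+1%:R * 'C(j.+1.*2, j.+1)%:R) ^+ 2 / (j.+1%:R * (4 * 4 ^+ j) ^+ 2).
  by rewrite /central_sq [4 ^+ j.+1]exprS; field; rewrite p4/= lt0r_neq0//; lra.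
rewrite E /central_sq -[j.+1%:R]natr1 -[j.*2.+1%:R]natr1 -muln2 natrM.
by field; rewrite p4/= ?lt0r_neq0//; lra.
Qed.

Lemma central_sq_gt0 (R : rcfType) j : (0 < j)%N -> 0 < central_sq R j.
Proof.
move=> j0; rewrite /central_sq mulr_gt0 ?ltr0n// exprn_gt0// divr_gt0 ?exprn_gt0//.
by rewrite ltr0n bin_gt0; lia.
Qed.

(** The product is the one in [coef_wallis_damp] at degree 2j, where the index j will sit as a power
    of the square root of z. *)
Lemma central_sq_prod (R : rcfType) j I : (0 < j)%N ->
  central_sq R (j + I) * \prod_(l < I) (1 - ((j.*2 + l.*2.+1)%:R ^+ 2)^-1)
  = central_sq R j.
Proof.
move=> j0; elim: I => [|I IH]; first by rewrite big_ord0 addn0 mulr1.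
rewrite big_ord_recr/= mulrCA -IH mulrC addnS; congr (_ * _).
rewrite -(@central_sqS R (j + I)) ?addn_gt0 ?j0//.
by congr (_ * (1 - (_%:R ^+ 2)^-1)); lia.
Qed.

Lemma central_sq_ge (R : rcfType) j : (0 < j)%N -> 4^-1 <= central_sq R j.
Proof.
case: j => // j _; elim: j => [|j IH].
  by rewrite /central_sq (_ : 'C(_, _) = 2%N)// expr1; lra.
have E := @central_sqS R j.+1 isT.
by rewrite (le_trans IH)// -E ger_pMr ?central_sq_gt0 ?gerBl ?invr_ge0 ?exprn_ge0.
Qed.

(** The correction 1/(2j), exact at j = 1, makes the induction close; later uses keep only the bound
    1/2. *)
Lemma central_sq_le (R : rcfType) j : (0 < j)%N ->
  central_sq R j <= 2^-1 * (1 - (2 * j%:R)^-1).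
Proof.
case: j => // j _; elim: j => [|j IH].
  by rewrite /central_sq (_ : 'C(_, _) = 2%N)// expr1; lra.
have E := @central_sqS R j.+1 isT.
have k0 : (0 : R) < j.+1%:R by rewrite ltr0n.
have d0 : 0 < 1 - (j.+1.*2.+1%:R ^+ 2)^-1 :> R.
  by rewrite subr_gt0 invf_lt1 ?exprn_gt0// -natrX ltr1n; nia.
rewrite -(ler_pM2r d0) E (le_trans IH)//.
move: k0; rewrite -[j.+2%:R]natr1 -[j.+1.*2.+1%:R]natr1 -muln2 natrM.
move: (j.+1%:R) => k k0.
rewrite -subr_ge0.
have -> : 2^-1 * (1 - (2 * (k + 1))^-1) * (1 - ((k * 2 + 1) ^+ 2)^-1) - 2^-1 * (1 - (2 * k)^-1)
  = 2^-1 / (2 * k * (2 * k + 1)).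
  by field; rewrite !lt0r_neq0//; lra.
by rewrite divr_ge0 ?mulr_ge0//; lra.
Qed.

(** The increment from k to k+1 is [central_sq R k] / (4k(k+1)), at most 1/(8k) - 1/(8(k+1)). Hence
    [central_sq R k] + 1/(8k) is nonincreasing. *)
Lemma central_sq_incr (R : rcfType) j i : (0 < j)%N ->
  central_sq R j <= central_sq R (j + i) <= central_sq R j + (8 * j%:R)^-1.
Proof.
move=> j0.
have step k : (0 < k)%N -> central_sq R k <= central_sq R k.+1 /\
    central_sq R k.+1 + (8 * k.+1%:R)^-1 <= central_sq R k + (8 * k%:R)^-1.
  move=> k0; have E := @central_sqS R k k0; have ub := central_sq_le R k0.
  have kR : (1 : R) <= k%:R by rewrite ler1n.
  move: E; rewrite -[k.*2.+1%:R]natr1 -[k.+1%:R]natr1 -muln2 natrM => E.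
  have E' : central_sq R k.+1 = central_sq R k * (1 + (4 * k%:R * (k%:R + 1))^-1).
    by rewrite -E; field; rewrite !lt0r_neq0//; lra.
  have A0 := central_sq_gt0 R k0; rewrite E'; split.
    by rewrite ler_peMr ?(ltW A0)// lerDl invr_ge0 ?mulr_ge0; lra.
  have ub' : central_sq R k <= 2^-1.
    have i0 : (0 : R) <= (2 * k%:R)^-1 by rewrite invr_ge0; lra.
    by rewrite (le_trans ub)//; lra.
  rewrite -subr_ge0.
  have -> : central_sq R k + (8 * k%:R)^-1 -
      (central_sq R k * (1 + (4 * k%:R * (k%:R + 1))^-1) + (8 * (k%:R + 1))^-1)
    = (2^-1 - central_sq R k) / (4 * k%:R * (k%:R + 1)).
    by field; rewrite !lt0r_neq0//; lra.
  by rewrite divr_ge0// ?subr_ge0// !mulr_ge0//; lra.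
have [h1 h2] : central_sq R j <= central_sq R (j + i) /\
    central_sq R (j + i) + (8 * (j + i)%:R)^-1 <= central_sq R j + (8 * j%:R)^-1.
  elim: i => [|i [IH1 IH2]]; first by rewrite addn0.
  have [s1 s2] := step (j + i)%N ltac:(by rewrite addn_gt0 j0).
  by rewrite addnS; split; [apply: le_trans s1|apply: (le_trans s2)].
by rewrite h1 (le_trans _ h2)// lerDl invr_ge0 mulr_ge0.
Qed.

(** * The kernel and its energy *)

Definition gs_kernel (R : realFieldType) (n : nat) (z : R) : R :=
  gs_mean n (fun j => j%:R * 'C(j.*2, j)%:R * (z / 4) ^+ j).

(** The antiderivative vanishing at 0, so [(primitive p).[1]] stands for the integral of p over
    [0, 1]. *)
Definition primitive (R : rcfType) (p : {poly R}) : {poly R} :=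
  'X * coef_shift_div 1 p.

Lemma deriv_primitive (R : rcfType) (p : {poly R}) : (primitive p)^`() = p.
Proof. by have := deriv_coef_shift_div 0 p; rewrite expr1 expr0 mul1r. Qed.

Lemma horner_primitive0 (R : rcfType) (p : {poly R}) : (primitive p).[0] = 0.
Proof. by rewrite /primitive hornerM hornerX mul0r. Qed.

Lemma primitive_linear (R : rcfType) (a b : R) (p q : {poly R}) :
  primitive (a *: p + b *: q) = a *: primitive p + b *: primitive q.
Proof.
rewrite /primitive !scalerAr -mulrDr; congr (_ * _); apply/polyP => i.
by rewrite coefD !coefZ !coef_coef_shift_div coefD !coefZ; ring.
Qed.

(** The polynomial k_n(z)/z for n > 0; indices are shifted by one because k_n has no constant
    term. *)
Definition gs_quot (R : rcfType) (n : nat) : {poly R} :=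
  \poly_(j < n) (gs_weight R n j.+1 * j.+1%:R * 'C(j.+1.*2, j.+1)%:R / 4 ^+ j.+1).

Lemma gs_quotE (R : rcfType) n (z : R) : (0 < n)%N ->
  gs_kernel n z = z * (gs_quot R n).[z].
Proof.
move=> n0; rewrite /gs_kernel /gs_mean big_ord_recl gs_weight0// mul0r add0r.
rewrite horner_poly mulr_sumr; apply: eq_bigr => j _.
by rewrite lift0 expr_div_n [z ^+ _]exprS; ring.
Qed.

Lemma coef_gs_quot (R : rcfType) n j : (gs_quot R n)`_j =
  gs_weight R n j.+1 * j.+1%:R * 'C(j.+1.*2, j.+1)%:R / 4 ^+ j.+1.
Proof. by rewrite coef_poly; case: ltnP => // nj; rewrite gs_weight_gt// !mul0r. Qed.

Lemma deriv_gs_quotS (R : rcfType) n :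
  ('X * gs_quot R n)^`() = ('X * gs_quot R n.+1)^`() - n.+1%:R *: gs_quot R n.+1.
Proof.
apply/polyP => j; rewrite coefB coefZ !coef_deriv !coefXM/= !coef_gs_quot.
have E := gs_weightS R n j.+1.
rewrite -[LHS]mulr_natr -[X in _ = X - _]mulr_natr.
set c : R := j.+1%:R * 'C(j.+1.*2, j.+1)%:R / 4 ^+ j.+1.
transitivity (c * (j.+1%:R * gs_weight R n j.+1)); first by rewrite /c; ring.
by rewrite -E /c; ring.
Qed.

(* The constant 10^4 absorbs the range m (1 - z) <= 20, in which the left-hand side
   may exceed the first term on the right. *)
Lemma decay_ineq (R : rcfType) (m z : R) : 20 <= m -> 0 <= z <= 1 ->
  5 * m * z * (1 - z) ^+ 4 <=
  (m ^+ 2 / 2 - m) * (1 - z) ^+ 5 + 10 ^+ 4 / m ^+ 2 * ((1 - z) * z ^+ 2).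
Proof.
move=> m20 /andP[z0 z1]; have y0 : 0 <= 1 - z by rewrite subr_ge0.
have [zh|zh] := lerP z 2^-1.
  have K0 : 0 <= 10 ^+ 4 / m ^+ 2 * ((1 - z) * z ^+ 2).
    by rewrite !mulr_ge0 ?exprn_ge0// ?invr_ge0 ?exprn_ge0//; lra.
  have h : 5 * m * z * (1 - z) ^+ 4 <= 5 * m * (1 - z) * (1 - z) ^+ 4.
    by rewrite ler_wpM2r ?exprn_ge0// ler_wpM2l//; lra.
  have h2 : 5 * m * (1 - z) ^+ 5 <= (m ^+ 2 / 2 - m) * (1 - z) ^+ 5.
    by rewrite ler_wpM2r ?exprn_ge0//; nra.
  by rewrite (le_trans h)// -mulrA -exprS; lra.
have m0 : 0 < m by lra.
(* Rescaling 1 - z by 1/m leaves, up to a nonnegative factor, a quartic in y. Since z > 1/2 and 1/2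
   - 1/m >= 1/4, it is at least (5/2) z (y^4 - 2 y^3 + 2). *)
pose y := m * (1 - z) / 10.
have yge0 : 0 <= y by rewrite divr_ge0// mulr_ge0// ltW.
rewrite -subr_ge0.
have -> : (m ^+ 2 / 2 - m) * (1 - z) ^+ 5 + 10 ^+ 4 / m ^+ 2 * ((1 - z) * z ^+ 2) -
   5 * m * z * (1 - z) ^+ 4 = (1 - z) * 10 ^+ 3 / m ^+ 2 * (
     10 * (2^-1 - m^-1) * y ^+ 4 + 10 * z ^+ 2 - 5 * z * y ^+ 3).
  by rewrite /y; field; rewrite lt0r_neq0.
apply: mulr_ge0.
  by rewrite divr_ge0 ?mulr_ge0 ?exprn_ge0// ltW.
have mi : m^-1 <= 4^-1 by rewrite lef_pV2 ?posrE//; lra.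
have y4 : 0 <= y ^+ 4 by rewrite exprn_ge0.
have h : 4^-1 * y ^+ 4 <= (2^-1 - m^-1) * y ^+ 4.
  by apply: ler_wpM2r => //; lra.
have h2 : z <= 2 * z ^+ 2 by nra.
have h3 : y ^+ 4 * z <= y ^+ 4 by apply: ler_piMr.
(* A sum-of-squares certificate for y^4 - 2 y^3 + 2 >= 0. *)
have s1 := sqr_ge0 (y ^+ 2 - y - 4 / 5); have s2 := sqr_ge0 (y - 4 / 3).
have h4 : 0 <= z * (y ^+ 4 - 2 * y ^+ 3 + 2).
  apply: mulr_ge0; first exact: z0.
  lra.
by lra.
Qed.

Definition gs_energy (R : rcfType) (n : nat) : R :=
  (primitive ((1 - 'X) ^+ 5 * ('X * gs_quot R n)^`() ^+ 2)).[1].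

Definition gs_quot_energy (R : rcfType) (n : nat) : R :=
  (primitive ((1 - 'X) ^+ 5 * gs_quot R n ^+ 2)).[1].

(** Inserting k_n' = k_(n+1)' - m k_(n+1)/z with m = n+1 and integrating the cross term by parts
    leaves a quadratic form in k_(n+1)/z, which [decay_ineq] controls; the pointwise bound 9 absorbs
    its error term. *)
Lemma gs_energyS (R : rcfType) n :
  (forall z : R, 0 <= z <= 1 -> gs_kernel n.+1 z ^+ 2 * (1 - z) <= 9) ->
  (20 <= n)%N ->
  gs_energy R n.+1 + n.+1%:R ^+ 2 / 2 * gs_quot_energy R n.+1
  <= gs_energy R n + (9 * 10 ^+ 4) / n.+1%:R ^+ 2.
Proof.
move=> bnd n20; set m : R := n.+1%:R.
have m20 : 20 <= m by rewrite ler_nat ltnW.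
have m0 : 0 < m by lra.
pose psi : {poly R} := (1 - 'X) ^+ 5.
pose v := gs_quot R n.+1; pose u := ('X * v)^`(); pose u1 := ('X * gs_quot R n)^`().
(* The last summand vanishes at 0 and 1 and performs the integration by parts of the cross term -2 m
   u v; the linear summand integrates the constant error. *)
pose q := primitive (psi * u1 ^+ 2) - primitive (psi * u ^+ 2)
  - (m ^+ 2 / 2) *: primitive (psi * v ^+ 2)
  + ((9 * 10 ^+ 4) / m ^+ 2) *: 'X + m *: (psi * 'X * v ^+ 2).
have : q.[0] <= q.[1].
  apply: horner_homo => // z z01.
  have d1z : (1 - 'X : {poly R})^`().[z] = -1.
    by rewrite derivB derivC derivX sub0r hornerN hornerC.
  have vz : (1 - z) * z ^+ 2 * v.[z] ^+ 2 <= 9.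
    by have := bnd z z01; rewrite gs_quotE// exprMn mulrC mulrA.
  have K0 : 0 <= 10 ^+ 4 / m ^+ 2 by rewrite divr_ge0 ?exprn_ge0// ltW.
  have vz' : 10 ^+ 4 / m ^+ 2 * ((1 - z) * z ^+ 2 * v.[z] ^+ 2) <=
    9 * 10 ^+ 4 / m ^+ 2 by rewrite -[9 * _ / _]mulrA mulrC ler_wpM2r.
  have D := ler_wpM2r (sqr_ge0 v.[z]) (decay_ineq m20 z01).
  have -> : q^`().[z] = ((m ^+ 2 / 2 - m) * (1 - z) ^+ 5 - 5 * m * z * (1 - z) ^+ 4)
      * v.[z] ^+ 2 + 9 * 10 ^+ 4 / m ^+ 2.
    rewrite /q !derivD !derivN !derivZ !deriv_primitive derivX.
    have -> : u1 = u - m *: v by rewrite /u1 deriv_gs_quotS.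
    rewrite /u !expr2 !derivM derivX mul1r.
    rewrite !(hornerD, hornerN, hornerZ, hornerM, hornerX, hornerC, d1z).
    by field; rewrite addrC natr1 lt0r_neq0.
  rewrite [leRHS]mulrDl -[_ / _ * _ * _]mulrA in D.
  by rewrite mulrBl addrAC subr_ge0 (le_trans D)// lerD2l.
have one1 : (1 : {poly R}).[1] = 1 by rewrite hornerE.
rewrite /q !(hornerD, hornerN, hornerZ, hornerM, hornerX) one1 subrr !(mul0r, mulr0).
rewrite /gs_energy /gs_quot_energy -/psi -/v -/u -/u1 /primitive !hornerM !hornerX.
rewrite !mul1r mulr1.
move: (m ^+ 2 / 2 * _) (9 * 10 ^+ 4 / m ^+ 2) (_ .[1]) (_ .[1]) => *; lra.
Qed.

(** The energy step bounds the integral of (1-t)^5 k_n'^2 by B and that of (1-t)^5 (k_n/t)^2 by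
    2B/n^2. A weighted Sobolev-type argument then turns the two into a pointwise bound. *)
Lemma gs_kernel_decay (R : rcfType) :
  (forall n (z : R), (0 < n)%N -> 0 <= z <= 1 -> gs_kernel n z ^+ 2 * (1 - z) <= 9) ->
  exists2 B : R, 0 <= B & forall n (z : R), (20 < n)%N -> 0 <= z <= 1 ->
    gs_kernel n z ^+ 2 * (1 - z) ^+ 5 <= B * z / n%:R.
Proof.
move=> bnd; pose D : R := 9 * 10 ^+ 4.
have psi_ge0 (z : R) : 0 <= z <= 1 -> 0 <= (1 - z) ^+ 5.
  by move=> /andP[_ z1]; rewrite exprn_ge0// subr_ge0.
have prim_ge0 (p : {poly R}) : (forall z, 0 <= z <= 1 -> 0 <= p.[z]) -> 0 <= (primitive p).[1].
  move=> p0; rewrite -(horner_primitive0 p); apply: horner_homo => // z z01.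
  by rewrite deriv_primitive p0.
have J0 n : 0 <= gs_quot_energy R n.
  apply: prim_ge0 => z z01; rewrite hornerM mulr_ge0//.
    by rewrite !hornerE psi_ge0.
  by rewrite horner_exp sqr_ge0.
have E0 n : 0 <= gs_energy R n.
  apply: prim_ge0 => z z01; rewrite hornerM mulr_ge0//.
    by rewrite !hornerE psi_ge0.
  by rewrite horner_exp sqr_ge0.
(* Adding D/n to the energy gives a nonincreasing quantity, because 1/(n+1)^2 <= 1/n - 1/(n+1). *)
have step n : (20 <= n)%N ->
    gs_energy R n.+1 + n.+1%:R ^+ 2 / 2 * gs_quot_energy R n.+1 + D / n.+1%:R
    <= gs_energy R n + D / n%:R.
  move=> n20; have := gs_energyS (fun z => bnd n.+1 z isT) n20.
  rewrite -/D -[n.+1%:R]natr1.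
  have n0 : (20 : R) <= n%:R by rewrite ler_nat.
  suff : D / (n%:R + 1) ^+ 2 + D / (n%:R + 1) <= D / n%:R by lra.
  rewrite -subr_ge0.
  have -> : D / n%:R - (D / (n%:R + 1) ^+ 2 + D / (n%:R + 1)) =
    D / (n%:R * (n%:R + 1) ^+ 2) by field; rewrite !lt0r_neq0//; lra.
  by rewrite divr_ge0 ?mulr_ge0 ?exprn_ge0//; lra.
have D0 : 0 <= D by rewrite mulr_ge0// exprn_ge0.
pose B := gs_energy R 20 + D / 20%:R.
have bndE n : (20 <= n)%N -> gs_energy R n + D / n%:R <= B.
  elim: n => // n IH; rewrite leq_eqVlt => /predU1P[<-//|n20].
  rewrite (le_trans _ (IH n20))// (le_trans _ (step _ n20))// lerD2r lerDl.
  by rewrite mulr_ge0// divr_ge0// exprn_ge0.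
have B0 : 0 <= B by rewrite addr_ge0// divr_ge0.
exists (3 * B); first by rewrite mulr_ge0.
case=> // n z n20 /andP[z0 z1].
set m : R := n.+1%:R; have m0 : 0 < m by rewrite ltr0n.
have EB : gs_energy R n.+1 <= B.
  by rewrite (le_trans _ (bndE n.+1 (ltnW n20)))// lerDl divr_ge0.
have JB : m ^+ 2 / 2 * gs_quot_energy R n.+1 <= B.
  have := le_trans (step n n20) (bndE n n20); rewrite -/m.
  have : 0 <= D / m by rewrite divr_ge0// ltW.
  by have := E0 n.+1; move: (D / m) (m ^+ 2 / 2 * _) => *; lra.
pose v := gs_quot R n.+1; pose u := ('X * v)^`().
(* With k_n = z v and u = k_n', the derivative of z v^2 is 2 v u - v^2, and 2 v u <= m v^2 + u^2/m.
   This weight balances both energies, giving total integral at most 2B/m + B/m. *)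
pose g := (1 - 'X) ^+ 5 * (m *: v ^+ 2 + m^-1 *: u ^+ 2).
have vuE (t : R) : ('X * v ^+ 2)^`().[t] = 2 * v.[t] * u.[t] - v.[t] ^+ 2.
  rewrite /u !expr2 !derivM derivX.
  by rewrite !(hornerD, hornerM, hornerX, hornerC); ring.
have gE (t : R) : g.[t] = (1 - t) ^+ 5 * (m * v.[t] ^+ 2 + m^-1 * u.[t] ^+ 2).
  rewrite /g hornerM (hornerD (_ *: _)) !hornerZ !horner_exp.
  by rewrite hornerD hornerN hornerX hornerE.
have g_ge (t : R) : 0 <= t <= 1 ->
    (1 - t) ^+ 5 * (2 * v.[t] * u.[t] - v.[t] ^+ 2) <= g.[t].
  move=> t01; rewrite gE ler_wpM2l ?psi_ge0//.
  rewrite -subr_ge0.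
  have -> : m * v.[t] ^+ 2 + m^-1 * u.[t] ^+ 2 - (2 * v.[t] * u.[t] - v.[t] ^+ 2)
    = m^-1 * (m * v.[t] - u.[t]) ^+ 2 + v.[t] ^+ 2.
    by field; rewrite addrC natr1 lt0r_neq0.
  by rewrite addr_ge0 ?sqr_ge0// mulr_ge0 ?sqr_ge0// invr_ge0 ltW.
have g_ge0 (t : R) : 0 <= t <= 1 -> 0 <= g.[t].
  move=> t01; rewrite gE mulr_ge0 ?psi_ge0//.
  by apply: addr_ge0; apply: mulr_ge0; rewrite ?sqr_ge0 ?invr_ge0 ?ltW.
have G1 : (primitive g).[1] <= 3 * B / m.
  have -> : primitive g =
      m *: primitive ((1 - 'X) ^+ 5 * v ^+ 2) + m^-1 *: primitive ((1 - 'X) ^+ 5 * u ^+ 2).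
    have -> : g = m *: ((1 - 'X) ^+ 5 * v ^+ 2) + m^-1 *: ((1 - 'X) ^+ 5 * u ^+ 2).
      by rewrite /g mulrDr -!scalerAr.
    exact: primitive_linear.
  rewrite hornerD !hornerZ -/(gs_quot_energy R n.+1) -/(gs_energy R n.+1).
  rewrite ler_pdivlMr//.
  have -> : (m * gs_quot_energy R n.+1 + m^-1 * gs_energy R n.+1) * m =
      2 * (m ^+ 2 / 2 * gs_quot_energy R n.+1) + gs_energy R n.+1.
    by field; rewrite addrC natr1 lt0r_neq0.
  by move: JB EB; move: (m ^+ 2 / 2 * _) (gs_energy _ _) => J E ? ?; lra.
have Gz : (primitive g).[z] <= (primitive g).[1].
  apply: horner_homo => // t /andP[zt t1]; rewrite deriv_primitive g_ge0//.
  by rewrite t1 (le_trans z0).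
have H : (1 - z) ^+ 5 * (z * v.[z] ^+ 2) <= (primitive g).[z].
  (* h' >= 0 because (1 - t)^5 decreases and g dominates 2 v u - v^2 by AM-GM. *)
  pose h := primitive g - (1 - z) ^+ 5 *: ('X * v ^+ 2).
  have : h.[0] <= h.[z].
    apply: horner_homo => // t /andP[t0 tz].
    have t01 : 0 <= t <= 1 by rewrite t0 (le_trans tz).
    rewrite derivB derivZ deriv_primitive !(hornerD, hornerN, hornerZ) vuE subr_ge0.
    have [s0|s0] := leP (2 * v.[t] * u.[t] - v.[t] ^+ 2) 0.
      by rewrite (le_trans _ (g_ge0 t t01))// mulr_ge0_le0// psi_ge0// z0.
    rewrite (le_trans _ (g_ge t t01))//; apply: ler_wpM2r; first exact: ltW.
    by rewrite lerXn2r// ?nnegrE ?subr_ge0// ?lerD2l ?lerN2//; case/andP: t01.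
  rewrite !(hornerD, hornerN, hornerZ, hornerM, hornerX, horner_primitive0).
  by rewrite !mul0r mulr0 subr0 subr_ge0 -expr2.
rewrite gs_quotE// -/v mulrC.
have -> : (1 - z) ^+ 5 * (z * v.[z]) ^+ 2 = z * ((1 - z) ^+ 5 * (z * v.[z] ^+ 2)) by ring.
rewrite [3 * B * z]mulrC -[z * _ / _]mulrA ler_wpM2l//.
by rewrite (le_trans H)// (le_trans Gz).
Qed.

(** * The uniform bound on the kernel *)

Lemma binD2 j k : ('C(j.+1.*2, (j.+1 + k).+1) =
  'C(j.*2, j + k) + 2 * 'C(j.*2, (j + k).+1) + 'C(j.*2, (j + k).+2))%N.
Proof. by rewrite doubleS addSn !binS; lia. Qed.

(** Multiplication by 4 cos^2 X sends the harmonic s_k to s_(k-1) + 2 s_k + s_(k+1), and double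
    Pascal does the same to the coefficients. At k = 0 both use the odd reflection s_(-1) = -s_0,
    b_(-1) = -b_0. *)
Lemma sin_cos_expn (R : realType) (X : R) j N : (j <= N)%N ->
  (2 * cos X) ^+ j.*2 * sin X =
  \sum_(k < N.+1) ('C(j.*2, j + k)%:R - 'C(j.*2, j + k.+1)%:R) * sin (k.*2.+1%:R * X).
Proof.
elim: j N => [|j IH] N jN.
  rewrite big_ord_recl big1 ?addr0; last first.
    by move=> i _; rewrite !add0n lift0 !bin_small// subrr mul0r.
  by rewrite expr0 !add0n/= bin0 bin_small// subr0 !mul1r.
pose b k : R := 'C(j.*2, j + k)%:R - 'C(j.*2, j + k.+1)%:R.
pose b' k : R := 'C(j.+1.*2, j.+1 + k)%:R - 'C(j.+1.*2, j.+1 + k.+1)%:R.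
pose s k : R := sin (k.*2.+1%:R * X).
have b0 k : (j < k)%N -> b k = 0.
  by move=> jk; rewrite /b !bin_small ?subrr//; lia.
have b'S k : b' k.+1 = 2 * b k.+1 + b k + b k.+2.
  rewrite /b' /b [(j.+1 + k.+1)%N]addnS [(j.+1 + k.+2)%N]addnS !binD2 !natrD ?natrM !addnS; ring.
have b'0 : b' 0%N = b 0%N + b 1%N.
  have E1 : 'C(j.+1.*2, j.+2) = ('C(j.*2, j) + 2 * 'C(j.*2, j.+1) + 'C(j.*2, j.+2))%N.
    by have := binD2 j 0; rewrite !addn0.
  have E0 : 'C(j.+1.*2, j.+1) = (2 * ('C(j.*2, j) + 'C(j.*2, j.+1)))%N.
    rewrite doubleS binS binS.
    have -> : 'C(j.*2.+1, j) = 'C(j.*2.+1, j.+1).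
      by rewrite -bin_sub; [congr 'C(_, _); lia|lia].
    by rewrite binS; lia.
  rewrite /b' /b !addn0 !addn1 E0 E1 addn2.
  by move: 'C(_, _) 'C(_, _) 'C(_, _) => c0 c1 c2; rewrite !(natrD, natrM); ring.
have oddE i : i.*2.+1%:R = 2 * i%:R + 1 :> R by rewrite -natr1 -muln2 natrM mulrC.
have sS k : 4 * cos X ^+ 2 * s k.+1 = 2 * s k.+1 + s k.+2 + s k.
  have -> : s k.+2 = sin (k.+1.*2.+1%:R * X + (X + X)).
    by congr sin; rewrite !oddE -!natr1; ring.
  have -> : s k = sin (k.+1.*2.+1%:R * X - (X + X)).
    by congr sin; rewrite !oddE -!natr1; ring.
  rewrite sinD sinB cosD -/(s k.+1); have := sin2cos2 X; rewrite !expr2 => ->; ring.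
have s0 : 4 * cos X ^+ 2 * s 0%N = s 0%N + s 1%N.
  have -> : s 1%N = sin (X + (X + X)).
    by congr sin; rewrite oddE; ring.
  have -> : s 0%N = sin X by rewrite /s oddE mulr0 add0r mul1r.
  by rewrite sinD cosD sinD; have := sin2cos2 X; rewrite !expr2 => ->; ring.
(* Summation by parts moves the second-order operator from the coefficients to the harmonics; the
   boundary terms vanish once M exceeds the support of b. *)
have tel M : \sum_(k < M.+1) b' k * s k =
    \sum_(k < M.+1) b k * (4 * cos X ^+ 2 * s k) + b M.+1 * s M - b M * s M.+1.
  elim: M => [|M IHM]; first by rewrite !big_ord1 /= s0 b'0; ring.
  by rewrite big_ord_recr/= IHM [in RHS]big_ord_recr/= sS b'S; ring.
rewrite doubleS !exprS -/(b' _).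
transitivity (\sum_(k < N.+1) b' k * s k) => //.
rewrite tel !b0 ?mul0r ?addr0 ?subr0//; last exact: ltnW.
transitivity (4 * cos X ^+ 2 * ((2 * cos X) ^+ j.*2 * sin X)); first by ring.
by rewrite (IH N (ltnW jN)) mulr_sumr; apply: eq_bigr => k _; rewrite /b /s; ring.
Qed.

Lemma gs_mean_cos_le (R : realType) n (X : R) : (0 < n)%N ->
  `|sin X * gs_mean n (fun j => (2 * cos X) ^+ j.*2 / 'C(j.*2, j)%:R)| <= 1.
Proof.
move=> n0.
have -> : sin X * gs_mean n (fun j => (2 * cos X) ^+ j.*2 / 'C(j.*2, j)%:R) =
    \sum_(k < n.+1) gs_law R n k * sin (k.*2.+1%:R * X).
  rewrite /gs_law /gs_mean mulr_sumr.
  under [RHS]eq_bigr do rewrite mulr_suml.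
  rewrite exchange_big/=; apply: eq_bigr => j _.
  have -> : sin X * (gs_weight R n j * ((2 * cos X) ^+ j.*2 / 'C(j.*2, j)%:R)) =
    gs_weight R n j / 'C(j.*2, j)%:R * ((2 * cos X) ^+ j.*2 * sin X) by ring.
  rewrite (@sin_cos_expn _ _ _ n) -1?ltnS// mulr_sumr; apply: eq_bigr => k _.
  by rewrite /bin_ratio; ring.
apply: (le_trans (ler_norm_sum _ _ _)).
rewrite -[leRHS](@sum_gs_law R n n)//; apply: ler_sum => k _.
rewrite normrM ger0_norm ?gs_law_ge0// ler_piMr ?gs_law_ge0//.
by rewrite ler_norml sin_geN1 sin_le1.
Qed.

(** With t = cos X, [gs_mean_cos_le] bounds p by 1/sqrt(1 - t^2) on [0, x]. Damping p costs a factor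
    3 and [central_sq] at most 1/2, hence 3/2. Powers t^(2j) are used so that the damping factors
    match [central_sq_prod]. *)
Lemma gs_kernel_le (R : realType) n (x : R) : (0 < n)%N -> 0 <= x < 1 ->
  `|gs_kernel n (x ^+ 2)| <= 3 / 2 / Num.sqrt (1 - x ^+ 2).
Proof.
move=> n0 /andP[x0 x1].
pose M := (Num.sqrt (1 - x ^+ 2))^-1.
have x21 : 0 < 1 - x ^+ 2 by rewrite subr_gt0 expr_lt1.
have M0 : 0 <= M by rewrite invr_ge0 sqrtr_ge0.
pose c j : R := gs_weight R n j * (4 ^+ j / 'C(j.*2, j)%:R).
pose p : {poly R} := \sum_(j < n.+1) c j *: 'X^(j.*2).
have pE t : p.[t] = \sum_(j < n.+1) c j * t ^+ j.*2.
  by rewrite horner_sum; apply: eq_bigr => j _; rewrite hornerZ hornerXn.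
have pM t : 0 <= t <= x -> `|p.[t]| <= M.
  move=> /andP[t0 tx].
  have t11 : -1 <= t <= 1 by apply/andP; split; lra.
  have tE := acosK t11; set X := acos t in tE.
  have t21 : 0 < 1 - t ^+ 2 by rewrite subr_gt0 expr_lt1// (le_lt_trans tx).
  have sE : sin X = Num.sqrt (1 - t ^+ 2).
    by rewrite -tE -sin2cos2 sqrtr_sqr ger0_norm// sin_ge0_pi// acos_ge0 ?acos_lepi.
  have := gs_mean_cos_le X n0; rewrite tE sE.
  have -> : gs_mean n (fun j => (2 * t) ^+ j.*2 / 'C(j.*2, j)%:R) = p.[t].
    rewrite pE; apply: eq_bigr => j _; rewrite /c exprMn -mul2n exprM.
    by rewrite (_ : 2 ^+ 2 = 4 :> R); [ring|rewrite -natrX].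
  rewrite normrM ger0_norm ?sqrtr_ge0// mulrC -ler_pdivlMr ?sqrtr_gt0// div1r => h.
  rewrite (le_trans h)// lef_pV2 ?posrE ?sqrtr_gt0// ler_sqrt//.
    by rewrite lerD2l lerN2 lerXn2r ?nnegrE.
  exact: ltW.
(* For finite I the damped polynomial reproduces the kernel only up to the factors [r I j], which
   lie within 1/I of 1; I is sent to infinity at the end. *)
pose r I j : R := central_sq R I / central_sq R (j + I).
have dampE I : (0 < I)%N -> central_sq R I * (wallis_damp I p).[x] =
    \sum_(j < n.+1) c j * central_sq R j * r I j * x ^+ j.*2.
  move=> I0.
  have -> : wallis_damp I p = \sum_(j < n.+1)
      (c j * \prod_(l < I) (1 - ((j.*2 + l.*2.+1)%:R ^+ 2)^-1)) *: 'X^(j.*2).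
    apply/polyP => i; rewrite coef_wallis_damp !coef_sum mulr_suml.
    apply: eq_bigr => j _; rewrite !coefZ !coefXn mulrAC.
    by case: eqP => [->//|_]; rewrite !mulr0.
  rewrite horner_sum mulr_sumr; apply: eq_bigr => -[[|j] jn] _ /=.
    by rewrite /c gs_weight0// !mul0r scale0r horner0 mulr0.
  rewrite hornerZ hornerXn /r -[in RHS](@central_sq_prod R j.+1 I)//.
  have a0 : 0 < central_sq R (j.+1 + I) by apply: central_sq_gt0.
  by field; rewrite lt0r_neq0.
have kE : gs_kernel n (x ^+ 2) = \sum_(j < n.+1) c j * central_sq R j * x ^+ j.*2.
  apply: eq_bigr => j _; rewrite /c /central_sq -mul2n exprM expr_div_n.
  have C0 := bin2_neq0 R j; rewrite -mul2n in C0.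
  by field; rewrite C0 expf_neq0.
pose W := \sum_(j < n.+1) `|c j * central_sq R j * x ^+ j.*2|.
have bnd I : (0 < I)%N -> `|gs_kernel n (x ^+ 2)| <= 3 / 2 * M + W / I%:R.
  move=> I0; have IR : (0 : R) < I%:R by rewrite ltr0n.
  rewrite -[gs_kernel _ _](subrK (central_sq R I * (wallis_damp I p).[x])) addrC.
  apply: (le_trans (ler_normD _ _)); apply: lerD.
    rewrite normrM ger0_norm; last by rewrite ltW// central_sq_gt0.
    have := central_sq_le R I0.
    have : 0 <= (2 * I%:R)^-1 :> R by rewrite invr_ge0 mulr_ge0.
    have := norm_horner_wallis_damp I M0 pM (_ : 0 <= x <= x).
    rewrite lexx x0 => /(_ isT) h1 h2 h3.
    have -> : 3 / 2 * M = 2^-1 * (3 * M) by ring.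
    by apply: ler_pM => //; [rewrite ltW// central_sq_gt0|lra].
  rewrite kE dampE// -sumrB /W mulr_suml (le_trans (ler_norm_sum _ _ _))//.
  apply: ler_sum => j _.
  have -> : c j * central_sq R j * x ^+ j.*2 - c j * central_sq R j * r I j * x ^+ j.*2 =
    c j * central_sq R j * x ^+ j.*2 * (1 - r I j) by ring.
  rewrite normrM ler_wpM2l//.
  have /andP[i1 i2] := central_sq_incr R j I0.
  have a4 := central_sq_ge R I0; rewrite addnC in i1 i2.
  have a0 : 0 < central_sq R (j + I) by rewrite (lt_le_trans _ i1)// central_sq_gt0.
  have -> : 1 - r I j = (central_sq R (j + I) - central_sq R I) / central_sq R (j + I).
    by rewrite /r; field; rewrite lt0r_neq0.
  rewrite ger0_norm ?divr_ge0 ?subr_ge0 ?(ltW a0)// ler_pdivrMr//.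
  rewrite lerBlDl (le_trans i2)// lerD2l invfM.
  have : 0 < I%:R^-1 :> R by rewrite invr_gt0.
  by move: (I%:R^-1) => y ?; nra.
apply/ler_addgt0Pr => e e0.
have W0 : 0 <= W by apply: sumr_ge0.
pose I := (Num.truncn (W / e)).+1.
have := bnd I isT; rewrite /M => h; rewrite (le_trans h)// lerD2l.
rewrite ler_pdivrMr ?ltr0n// mulrC -ler_pdivrMr//.
by rewrite ltW// truncnS_gt// divr_ge0// ltW.
Qed.

Lemma gs_kernel_sqr_le (R : realType) n (z : R) : (0 < n)%N -> 0 <= z <= 1 ->
  gs_kernel n z ^+ 2 * (1 - z) <= 9.
Proof.
move=> n0 /andP[z0]; rewrite le_eqVlt => /predU1P[->|z1].
  by rewrite subrr mulr0.
have xz : Num.sqrt z ^+ 2 = z by rewrite sqr_sqrtr.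
have x1 : 0 <= Num.sqrt z < 1 by rewrite sqrtr_ge0 -[ltRHS]sqrtr1 ltr_sqrt.
have := gs_kernel_le n0 x1; rewrite xz.
have z10 : 0 < 1 - z by rewrite subr_gt0.
rewrite ler_pdivlMr ?sqrtr_gt0// => h.
have : (`|gs_kernel n z| * Num.sqrt (1 - z)) ^+ 2 <= (3 / 2) ^+ 2.
  by rewrite lerXn2r// nnegrE ?mulr_ge0 ?sqrtr_ge0//; lra.
rewrite exprMn real_normK ?num_real// sqr_sqrtr; last exact: ltW.
by move=> /le_trans; apply; lra.
Qed.

(** * The Gaver-Stehfest coefficients *)

(** Enlarging the range costs nothing below k/2, where the last binomial vanishes. For j > k
    truncated subtraction would give C(j,0) = 1, hence the explicit guard. *)
Lemma gs_coefE (R : realType) n k : (0 < k)%N ->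
  gs_coef R n k = \sum_(j < n.+1) gs_weight R n j * (j%:R * 'C(j.*2, j)%:R) *
    (if (j <= k)%N then (-1) ^+ (k - j) * 'C(j, k - j)%:R else 0).
Proof.
move=> k0; rewrite /gs_coef.
pose F j : R := j%:R ^+ n.+1 * 'C(n, j)%:R * 'C(j.*2, j)%:R * 'C(j, k - j)%:R.
have -> : \sum_((k.+1)./2 <= j < (minn k n).+1) F j =
    \sum_(0 <= j < n.+1 | (j <= k)%N) F j.
  rewrite (big_nat_widenl _ 0)//= (big_nat_widen _ _ n.+1) ?ltnS ?geq_minr//=.
  rewrite !big_mkord [LHS]big_mkcond [RHS]big_mkcond/=; apply: eq_bigr => j _.
  rewrite ltnS leq_min -[(j <= n)%N]ltnS ltn_ord andbT.
  case: (leqP j k) => jk; rewrite ?andbF//= andbT.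
  case: ifPn => //; rewrite -ltnNge => kj.
  by rewrite /F (@bin_small j) ?mulr0//; lia.
rewrite big_mkord big_mkcond mulr_sumr; apply: eq_bigr => j _.
case: leqP => jk; last by rewrite !mulr0.
rewrite /F /gs_weight.
have -> : (-1) ^+ (n + k) = (-1) ^+ (n + j) * (-1) ^+ (k - j) :> R.
  by rewrite -exprD; congr (_ ^+ _); lia.
by rewrite exprS; ring.
Qed.

(** Substituting k = i + j exhibits Stehfest's scheme as the extrapolation [gs_mean] of Gaver's
    functionals, which are j-th differences of phi times j C(2j,j). *)
Lemma sum_gs_coef (R : realType) n (phi : nat -> R) :
  \sum_(1 <= k < n.*2.+1) gs_coef R n k * phi k =
  gs_mean n (fun j => j%:R * 'C(j.*2, j)%:R *
    \sum_(i < j.+1) (-1) ^+ i * 'C(j, i)%:R * phi (i + j)%N).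
Proof.
transitivity (\sum_(1 <= k < n.*2.+1) \sum_(j < n.+1)
   gs_weight R n j * (j%:R * 'C(j.*2, j)%:R) *
    (if (j <= k)%N then (-1) ^+ (k - j) * 'C(j, k - j)%:R * phi k else 0)).
  rewrite !big_nat; apply: eq_bigr => k /andP[k1 _].
  rewrite gs_coefE// mulr_suml; apply: eq_bigr => j _.
  by case: leqP => _; rewrite ?mulr0 ?mul0r// !mulrA.
rewrite exchange_big/=; apply: eq_bigr => -[[|j] jn] _.
  rewrite /= mulr0n !mul0r mulr0; apply: big1 => k _.
  by rewrite !(mulr0n, mul0r, mulr0).
rewrite -mulr_sumr -[LHS]mulrA; congr (_ * (_ * _)) => /=.
rewrite (@big_cat_nat _ _ _ j.+1)//=; last by lia.
rewrite big_nat big1 ?add0r => [|k /andP[_ kj]]; last by rewrite leqNgt kj.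
rewrite -{1}[j.+1]add0n big_addn.
transitivity (\sum_(0 <= i < n.*2.+1 - j.+1) (-1) ^+ i * 'C(j.+1, i)%:R * phi (i + j.+1)%N).
  by apply: eq_bigr => i _; rewrite leq_addl addnK.
rewrite (@big_cat_nat _ _ _ j.+2)//=; last by lia.
rewrite [X in _ + X]big_nat [X in _ + X]big1 ?addr0 ?big_mkord// => i /andP[ji _].
by rewrite bin_small ?mulr0 ?mul0r.
Qed.

Lemma sum_gs_coef_expn (R : realType) n (w : R) :
  \sum_(1 <= k < n.*2.+1) gs_coef R n k * w ^+ k = gs_kernel n (4 * w * (1 - w)).
Proof.
rewrite sum_gs_coef; apply: eq_bigr => j _; congr (_ * (_ * _)).
rewrite (_ : 4 * w * (1 - w) / 4 = w * (1 - w)); last by field.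
rewrite exprMn exprBn mulr_sumr; apply: eq_bigr => i _.
by rewrite expr1n mulr1 exprD -[X in _ = _ * X]mulr_natr; ring.
Qed.

(** The beta integral of t^(a-1) (1-t)^n, proved by induction: Pascal's rule writes order n+1 at a
    as order n at a minus order n at a+1. *)
Lemma alt_sum_bin_inv (R : realFieldType) n (a : R) : 0 < a ->
  \sum_(i < n.+1) (-1) ^+ i * 'C(n, i)%:R / (i%:R + a) =
  n`!%:R / \prod_(i < n.+1) (a + i%:R).
Proof.
elim: n a => [|n IH] a a0.
  by rewrite !big_ord1 /= expr0 bin0 mul1r add0r addr0 fact0.
pose f i : R := (-1) ^+ i * 'C(n, i)%:R / (i%:R + a).
have f0 : f n.+1 = 0 by rewrite /f bin_small// mulr0 mul0r.
transitivity (\sum_(i < n.+1) f i -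
   \sum_(i < n.+1) (-1) ^+ i * 'C(n, i)%:R / (i%:R + (a + 1))).
  have -> : \sum_(i < n.+1) f i = \sum_(i < n.+2) f i.
    by rewrite [RHS]big_ord_recr/= f0 addr0.
  rewrite [LHS]big_ord_recl [X in _ = X - _]big_ord_recl -[RHS]addrA -sumrB.
  congr (_ + _); first by rewrite /f !bin0.
  apply: eq_bigr => i _; rewrite /f lift0 binS natrD exprS -natr1.
  have -> : i%:R + (a + 1) = i%:R + 1 + a by ring.
  by ring.
rewrite !IH ?addr_gt0//.
have P i : 0 < a + i%:R by rewrite ltr_wpDr.
have PP (b : R) m : 0 < b -> \prod_(i < m) (b + i%:R) != 0.
  by move=> b0; apply/prodf_neq0 => i _; rewrite lt0r_neq0// ltr_wpDr.
have E1 : \prod_(i < n.+2) (a + i%:R) = (\prod_(i < n.+1) (a + i%:R)) * (a + n.+1%:R).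
  by rewrite big_ord_recr.
have E2 : \prod_(i < n.+2) (a + i%:R) = a * \prod_(i < n.+1) (a + 1 + i%:R).
  rewrite big_ord_recl addr0; congr (_ * _); apply: eq_bigr => i _.
  by rewrite lift0 -natr1; ring.
have N1 := PP a n.+1 a0; have N2 := PP (a + 1) n.+1 (addr_gt0 a0 ltr01).
have N3 := PP a n.+2 a0.
have -> : (\prod_(i < n.+1) (a + i%:R))^-1 = (a + n.+1%:R) / \prod_(i < n.+2) (a + i%:R).
  by rewrite E1 invfM mulrCA divff ?mulr1// lt0r_neq0.
have -> : (\prod_(i < n.+1) (a + 1 + i%:R))^-1 = a / \prod_(i < n.+2) (a + i%:R).
  by rewrite E2 invfM mulrA divff ?mul1r// lt0r_neq0.
by rewrite factS natrM; ring.
Qed.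

(** The kernel has mass 1: each Gaver functional sends k to 1/k to exactly 1 by the beta identity,
    and M_n[1] = 1. *)
Lemma sum_gs_coef_inv (R : realType) n : (0 < n)%N ->
  \sum_(1 <= k < n.*2.+1) gs_coef R n k / k%:R = 1.
Proof.
move=> n0; rewrite (sum_gs_coef n (fun k => k%:R^-1)) -[RHS](gs_mean1 R n).
apply: eq_gs_mean => // j /andP[j0 _].
under eq_bigr do rewrite natrD.
have jR : (0 : R) < j%:R by rewrite ltr0n.
rewrite alt_sum_bin_inv//.
have prodE b m : (\prod_(i < m) (b.+1 + i)%N * b`! = (b + m)`!)%N.
  elim: m => [|m IHm]; first by rewrite big_ord0 mul1n addn0.
  by rewrite big_ord_recr/= mulnAC IHm addnS factS mulnC addSn.
have E : 'C(j.*2, j)%:R * j`!%:R * j%:R = \prod_(i < j.+1) (j%:R + i%:R) :> R.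
  case: j j0 jR => // b _ _; apply: (mulIf (fact_neq0 R b)).
  under eq_bigr do rewrite -natrD.
  rewrite -natr_prod -!natrM; congr (_%:R); rewrite prodE.
  have := @bin_fact b.+1.*2 b.+1 ltac:(lia).
  rewrite (_ : b.+1.*2 - b.+1 = b.+1)%N; last lia.
  rewrite (_ : b + b.+2 = b.+1.*2)%N; last lia.
  by move=> <-; rewrite -!mulnA -factS.
have C0 := bin2_neq0 R j.
by rewrite -E; field; rewrite C0 fact_neq0 lt0r_neq0.
Qed.

(** * Integrability and convergence *)

Lemma dyadic_bracket (R : realType) (v : R) : 0 < v < 1 ->
  exists i : nat, 2^-1 ^+ i.+1 < v <= 2^-1 ^+ i.
Proof.
move=> /andP[v0 v1].
have ex : exists n, 2^-1 ^+ n < v.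
  have := @cvg_expr R 2^-1 ltac:(rewrite ger0_norm; lra).
  move=> /cvgrPdist_lt /(_ _ v0)[N _ /(_ N (leqnn N))].
  by rewrite /= sub0r normrN ger0_norm ?exprn_ge0// => ?; exists N.
case: (ex_minnP ex) => -[|i] iv imin; first by rewrite expr0 ltNge ltW in iv.
exists i; rewrite iv/= leNgt; apply/negP => /imin; by rewrite ltnn.
Qed.

Lemma measurable_dist_powR (R : realType) (x alpha : R) :
  measurable_fun [set: R] (fun t => `|t - x| `^ alpha / `|t - x|).
Proof.
have md : measurable_fun [set: R] (fun t => `|t - x|).
  by apply: measurableT_comp => //; exact: measurable_funB.
have mp (r : R) : measurable_fun [set: R] (fun t => `|t - x| `^ r).
  by apply: (@measurableT_comp _ _ _ _ _ _ (@powR R ^~ r)) => //; exact: measurable_powR.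
rewrite (_ : (fun _ => _) = (fun t => `|t - x| `^ alpha * `|t - x| `^ (-1))).
  exact: measurable_funM.
by apply/funext => t; rewrite powR_inv1.
Qed.

(** A dyadic majorant: on the shell of radius about 2^(-i) the integrand is at most 2 (2q)^i with q
    = 2^(-alpha). The ball [B i] has length 2 times 2^(-i), so the integrals are dominated by the
    geometric series 4 q^i. *)
Lemma integral_dist_powR_lty (R : realType) (x alpha : R) : 0 < alpha ->
  (\int[lebesgue_measure]_(t in `](x - 1)%R, (x + 1)%R[)
     (`|t - x| `^ alpha / `|t - x|)%R%:E < +oo)%E.
Proof.
move=> a0; pose q : R := 2^-1 `^ alpha.
have q0 : 0 < q by rewrite powR_gt0.
have q1 : q < 1.
  have -> : 1 = 1 `^ alpha :> R by rewrite powR1.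
  apply: gt0_ltr_powR => //; rewrite ?nnegrE; lra.
pose B i : set R := [set` `[x - 2^-1 ^+ i, x + 2^-1 ^+ i]].
pose g i := fun t : R => ((2 * (2 * q) ^+ i) * \1_(B i) t)%:E.
have g0 i t : (0 <= g i t)%E.
  by rewrite lee_fin mulr_ge0// mulr_ge0// exprn_ge0// mulr_ge0// ltW.
have mg i : measurable_fun [set: R] (g i).
  apply/measurable_EFinP; apply: measurable_funM => //.
  by apply: measurable_indic; exact: measurable_itv.
have le_g t : `]x - 1, x + 1[%classic t ->
    ((`|t - x| `^ alpha / `|t - x|)%R%:E <= \sum_(0 <= i <oo) g i t)%E.
  rewrite /= in_itv/= => /andP[t1 t2].
  (* At t = x the inverse of 0 is 0, so the integrand takes the value 0. *)
  have [->|tx] := eqVneq t x.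
    by rewrite subrr normr0 invr0 mulr0 nneseries_ge0.
  have v0 : 0 < `|t - x| by rewrite normr_gt0 subr_eq0.
  have v1 : `|t - x| < 1 by rewrite ltr_norml; lra.
  have [i /andP[iv vi]] : exists i : nat, 2^-1 ^+ i.+1 < `|t - x| <= 2^-1 ^+ i.
    by apply: dyadic_bracket; rewrite v0.
  have Bt : B i t.
    by rewrite /B/= in_itv/= -ler_distlC distrC.
  apply: (@le_trans _ _ (g i t)).
    rewrite /g indicE mem_set// mulr1 lee_fin.
    have h1 : `|t - x| `^ alpha <= q ^+ i.
      rewrite -[q ^+ i]powR_mulrn ?(ltW q0)// -powRrM mulrC powRrM powR_mulrn//.
      by apply: ge0_ler_powR; rewrite ?nnegrE ?exprn_ge0// ltW.
    have h2 : `|t - x|^-1 <= 2 * 2 ^+ i.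
      rewrite -[leRHS]invrK lef_pV2 ?posrE ?invr_gt0 ?mulr_gt0 ?exprn_gt0//.
      by rewrite invfM -exprVn -exprS ltW.
    have -> : 2 * (2 * q) ^+ i = q ^+ i * (2 * 2 ^+ i) by rewrite exprMn; ring.
    by apply: ler_pM; rewrite ?powR_ge0 ?invr_ge0.
  apply: le_trans (nneseries_lim_ge i.+1 (fun k _ _ => g0 k t)).
  by rewrite big_nat_recr//= leeDr// sume_ge0.
have mD : measurable (`]x - 1, x + 1[%classic : set R) by [].
apply: (@le_lt_trans _ _
  (\int[lebesgue_measure]_(t in `](x - 1)%R, (x + 1)%R[) \sum_(0 <= i <oo) g i t)%E).
  apply: ge0_le_integral => //.
  - apply/measurable_EFinP; apply: measurable_funTS; exact: measurable_dist_powR.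
  - apply: ge0_emeasurable_sum => // k _; exact: measurable_funTS (mg k).
rewrite integral_nneseries//; last by move=> n; exact: measurable_funTS (mg n).
have Ig i : (\int[lebesgue_measure]_(t in `](x - 1)%R, (x + 1)%R[) g i t <= (4 * q ^+ i)%R%:E)%E.
  rewrite /g; under eq_integral do rewrite EFinM.
  rewrite ge0_integralZl//; last 2 first.
  - by apply/measurable_EFinP; apply: measurable_indic; exact: measurable_itv.
  - by rewrite lee_fin mulr_ge0// exprn_ge0// mulr_ge0// ltW.
  rewrite integral_indic//; last exact: measurable_itv.
  have -> : 4 * q ^+ i = (2 * (2 * q) ^+ i) * (2 * 2^-1 ^+ i).
    by rewrite exprMn exprVn; field; rewrite expf_neq0.
  rewrite [X in (_ <= X)%E]EFinM lee_wpmul2l ?lee_fin ?mulr_ge0 ?exprn_ge0 ?mulr_ge0 ?(ltW q0)//.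
  apply: (@le_trans _ _ (lebesgue_measure (B i))).
    apply: le_measure; [|rewrite inE; exact: measurable_itv|exact: subIsetl].
    by rewrite inE; apply: measurableI => //; exact: measurable_itv.
  rewrite /B lebesgue_measure_itv/=; case: ifPn => _.
    by rewrite -EFinD lee_fin; lra.
  by rewrite lee_fin mulr_ge0// exprn_ge0.
have S : (\sum_(0 <= i <oo) \int[lebesgue_measure]_(t in `](x - 1)%R, (x + 1)%R[) g i t
    <= \sum_(0 <= i <oo) (4 * q ^+ i)%R%:E)%E.
  by apply: lee_nneseries => [j _ _|j _]; [apply: integral_ge0 => t _; exact: g0|exact: Ig].
apply: (le_lt_trans S).
rewrite (_ : (fun n => \sum_(0 <= i < n) (4 * q ^+ i)%R%:E)%E = EFin \o series (geometric 4 q)).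
  have cg := @cvg_geometric_series R 4 q ltac:(by rewrite ger0_norm ?ltW).
  by rewrite EFin_lim ?ltry//; apply/cvg_ex; eexists; exact: cg.
by apply/funext => n /=; rewrite /series/= sumEFin.
Qed.

(** * Domination and pointwise limit of the kernel *)

(** For z >= 1/2 the uniform bound gives 9 <= 18 z. For z < 1/2 the decay bound applies with (1 -
    z)^4 >= 1/16, whence the constant 16 B. *)
Lemma gs_kernel_dominated (R : realType) :
  exists2 A : R, 0 <= A & forall n (z : R), (20 < n)%N -> 0 <= z <= 1 ->
    gs_kernel n z ^+ 2 * (1 - z) <= A * z.
Proof.
have [B B0 bB] := gs_kernel_decay (@gs_kernel_sqr_le R).
exists (18 + 16 * B); first by rewrite addr_ge0// mulr_ge0.
move=> n z n20 /andP[z0 z1].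
have n0 : (0 < n)%N by rewrite (leq_trans _ n20).
have z01 : 0 <= z <= 1 by rewrite z0.
have [zh|zh] := leP 2^-1 z.
  apply: (le_trans (gs_kernel_sqr_le n0 z01)).
  have : 0 <= B * z by rewrite mulr_ge0.
  lra.
have h := bB n z n20 z01.
have k0 : 0 <= gs_kernel n z ^+ 2 * (1 - z) by rewrite mulr_ge0 ?sqr_ge0// subr_ge0.
have q : 16^-1 <= (1 - z) ^+ 4.
  have -> : 16^-1 = (2^-1) ^+ 4 :> R by field.
  by rewrite lerXn2r ?nnegrE//; lra.
have h1 : gs_kernel n z ^+ 2 * (1 - z) * 16^-1 <= gs_kernel n z ^+ 2 * (1 - z) ^+ 5.
  by rewrite [_ ^+ 5]exprS mulrA ler_wpM2l.
have h2 : B * z / n%:R <= B * z.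
  rewrite ler_piMr ?mulr_ge0// invf_le1 ?ltr0n// ler1n //.
have := le_trans h1 (le_trans h h2); lra.
Qed.

Lemma cvg_gs_kernel (R : realType) (z : R) : 0 <= z < 1 ->
  gs_kernel n z @[n --> \oo] --> (0 : R).
Proof.
move=> /andP[z0 z1].
have [B B0 bB] := gs_kernel_decay (@gs_kernel_sqr_le R).
have z1' : 0 < 1 - z by rewrite subr_gt0.
have p0 : 0 < (1 - z) ^+ 5 by rewrite exprn_gt0.
apply/cvgrPdist_le => e e0.
pose M := (e ^+ 2 * (1 - z) ^+ 5)^-1 * (B * z).
exists (Num.truncn M + 21)%N => // n /= Mn.
have n20 : (20 < n)%N by lia.
have n0 : (0 : R) < n%:R by rewrite ltr0n; lia.
rewrite sub0r normrN -(@ler_pXn2r _ 2)// ?nnegrE ?(ltW e0)// real_normK ?num_real//.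
have z01 : 0 <= z <= 1 by rewrite z0 ltW.
rewrite -(ler_pM2r p0) (le_trans (bB n z n20 z01))//.
rewrite ler_pdivrMr// -ler_pdivrMl ?mulr_gt0 ?exprn_gt0//.
apply/ltW/(lt_le_trans (truncnS_gt M)).
by rewrite ler_nat (leq_trans _ Mn)// -addn1 leq_add2l.
Qed.

(** Both signs of u follow from exp(v) >= 1 + v. With u = c (s - x) this bounds 1/|1 - 2w| by 1 +
    1/|u|. *)
Lemma norm_onemB_expR (R : realType) (u : R) : u != 0 ->
  1 <= `|1 - expR (- u)| * (1 + `|u|^-1).
Proof.
move=> u0; have au0 : 0 < `|u| by rewrite normr_gt0.
have -> : 1 + `|u|^-1 = (1 + `|u|) / `|u| by field; rewrite lt0r_neq0.
rewrite mulrA ler_pdivlMr// mul1r.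
case: (ltrgt0P u) u0 au0 => // [u0 _ _|u0 _ _].
  have e1 : expR (- u) * (1 + u) <= 1.
    by rewrite expRN mulrC ler_pdivrMr ?expR_gt0// mul1r expR_ge1Dx.
  have e2 : expR (- u) <= 1 by rewrite -expR0 ler_expR; lra.
  by rewrite ger0_norm ?subr_ge0//; nra.
have e1 := expR_ge1Dx (- u).
by rewrite ltr0_norm; [nra|lra].
Qed.

Lemma gs_kernel_expR (R : realType) (c s : R) :
  0 < c -> 0 < s -> let w := expR (- (c * s)) in
  [/\ 0 <= 4 * w * (1 - w) <= 1, 1 - 4 * w * (1 - w) = (1 - 2 * w) ^+ 2 &
      4 * w * (1 - w) <= (2 * expR (- (c / 2 * s))) ^+ 2].
Proof.
move=> c0 s0 w.
have w0 : 0 < w := expR_gt0 _.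
have w1 : w <= 1 by rewrite -expR0 ler_expR oppr_le0 mulr_ge0 ?ltW.
have wE : expR (- (c / 2 * s)) ^+ 2 = w.
  by rewrite /w -expRM_natl; congr expR; field.
split.
- apply/andP; split; first by rewrite !mulr_ge0 ?subr_ge0 ?(ltW w0).
  have := sqr_ge0 (1 - 2 * w); lra.
- by ring.
- by rewrite exprMn wE -natrX; nra.
Qed.

Lemma integral_expR_mulN (R : realType) (z : R) : 0 < z ->
  (\int[lebesgue_measure]_(t in `]0%R, +oo[) (expR (- (z * t)))%:E = z^-1%:E)%E.
Proof.
move=> z0; have zn : z != 0 by rewrite lt0r_neq0.
have ce : continuous (fun t : R => expR (- (z * t))).
  move=> t; apply: continuous_comp; last exact: continuous_expR.
  by apply: cvgN; apply: mulrl_continuous.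
have cF : continuous (fun t : R => - (expR (- (z * t)) / z)).
  by move=> t; apply: cvgN; apply: cvgM; [exact: ce|exact: cvg_cst].
rewrite integral_itv_obnd_cbnd; last first.
  apply/measurable_EFinP/measurable_funTS; exact: continuous_measurable_fun.
rewrite (@ge0_continuous_FTC2y _ _ (fun t => - (expR (- (z * t)) / z)) 0 0).
- by rewrite mulr0 oppr0 expR0 mul1r -EFinB sub0r opprK.
- by move=> t _; exact: expR_ge0.
- exact: continuous_subspaceT.
- rewrite -oppr0; apply: cvgN; rewrite -(mul0r z^-1); apply: cvgM; last exact: cvg_cst.
  apply: (@cvg_comp _ _ _ (fun t => z * t) (fun y => expR (- y)) _ (pinfty_nbhs R)).
    exact: gt0_cvgMry.
  exact: cvgr_expR.
- by move=> t _; exact: ex_derive.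
- apply/cvg_at_right_filter; exact: cF.
- move=> t _.
  have -> : (fun t => - (expR (- (z * t)) / z)) = (fun t : R => (- z^-1) * expR (- z * t)).
    by apply/funext => u; rewrite !mulNr mulrC.
  rewrite derive1Ml// derive1_comp// derive1Ml// derive1_id mulr1 derive1E.
  have /funeqP -> := @derive_expR R.
  by rewrite [- z * t]mulNr; field.
Qed.

Lemma expR_half (R : realType) (c x s : R) : c * x = ln 2 ->
  2 * expR (- (c * s)) = expR (- (c * (s - x))).
Proof.
move=> cx; have -> : - (c * (s - x)) = ln 2 + - (c * s) by rewrite -cx; ring.
by rewrite expRD lnK// posrE.
Qed.

(** Domination gives |k_n| |1 - 2w| <= sqrt(A z), and z <= 4w leaves sqrt w, which explains the
    halved rate c/2. *)
Lemma gs_kernel_expR_le (R : realType) (c x : R) : 0 < c -> c * x = ln 2 ->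
  exists2 C : R, 0 <= C & forall n (s : R), (20 < n)%N -> 0 < s -> s != x ->
    `|gs_kernel n (4 * expR (- (c * s)) * (1 - expR (- (c * s))))|
    <= C * expR (- (c / 2 * s)) * (1 + `|c * (s - x)|^-1).
Proof.
move=> c0 cx; have [A A0 bA] := gs_kernel_dominated R.
exists (Num.sqrt A * 2) => [|n s n20 s0 sx]; first by rewrite mulr_ge0 ?sqrtr_ge0.
have [z01 zE zw] := gs_kernel_expR c0 s0.
set k := gs_kernel _ _; set e := expR (- (c / 2 * s)).
have e0 : 0 < e := expR_gt0 _.
have h : `|k| * `|1 - 2 * expR (- (c * s))| <= Num.sqrt A * 2 * e.
  rewrite -(@ler_pXn2r _ 2)// ?nnegrE ?mulr_ge0 ?sqrtr_ge0 ?(ltW e0)//.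
  rewrite exprMn !real_normK ?num_real// -zE (le_trans (bA n _ n20 z01))//.
  have -> : (Num.sqrt A * 2 * e) ^+ 2 = A * (2 * e) ^+ 2.
    by rewrite -mulrA exprMn sqr_sqrtr.
  by rewrite ler_wpM2l.
have u0 : c * (s - x) != 0 by rewrite mulf_neq0 ?subr_eq0// lt0r_neq0.
have := norm_onemB_expR u0; rewrite -(expR_half _ cx) => h1.
have p0 : 0 <= 1 + `|c * (s - x)|^-1 by rewrite addr_ge0// invr_ge0.
by rewrite (le_trans _ (ler_wpM2r p0 h))// -mulrA ler_peMr.
Qed.

Lemma cvg_gs_kernel_expR (R : realType) (c x s : R) :
  0 < c -> c * x = ln 2 -> 0 < s -> s != x ->
  gs_kernel n (4 * expR (- (c * s)) * (1 - expR (- (c * s)))) @[n --> \oo] --> (0 : R).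
Proof.
move=> c0 cx s0 sx; apply: cvg_gs_kernel.
have [/andP[-> z1] zE _] := gs_kernel_expR c0 s0.
rewrite /= -subr_gt0 zE lt0r sqr_ge0 andbT sqrf_eq0 subr_eq0 (expR_half _ cx).
rewrite -[X in X == _]expR0 (inj_eq (@expR_inj R)) eq_sym oppr_eq0.
by rewrite mulf_neq0 ?subr_eq0// lt0r_neq0.
Qed.

(* In the application phi is the identity map from R with the completed
   sigma-algebra to R with the Borel one; it transfers integrals of Borel functions. *)
Lemma measurable_preimage_phi d (T : measurableType d) (R : realType)
    (phi : T -> R) (E : set R) : measurable_fun [set: T] phi ->
  measurable E -> measurable (phi @^-1` E).
Proof. by move=> mphi mE; rewrite -[X in measurable X]setTI; exact: mphi. Qed.

Lemma ge0_integral_phi d (T : measurableType d) (R : realType)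
    (mu : {measure set T -> \bar R}) (phi : T -> R) (E : set R) (g : R -> \bar R) :
  measurable_fun [set: T] phi ->
  (forall A : set R, measurable A -> mu (phi @^-1` A) = lebesgue_measure A) ->
  measurable E -> measurable_fun [set: R] g -> (forall s, 0 <= g s)%E ->
  (\int[mu]_(t in phi @^-1` E) g (phi t) = \int[lebesgue_measure]_(s in E) g s)%E.
Proof.
move=> mphi muphi mE mg g0.
rewrite -[LHS](@ge0_integral_pushforward _ _ T (measurableTypeR R) R phi mphi mu E g)//.
- by apply: eq_measure_integral => A mA _; exact: muphi.
- exact: measurable_funTS.
Qed.

Lemma measurable_fun_expR_phi d (T : measurableType d) (R : realType)
    (phi : T -> R) (z : R) (D : set T) : measurable_fun [set: T] phi ->
  measurable_fun D (fun t => expR (- (z * phi t))).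
Proof.
move=> mphi; apply: measurable_funTS; apply: measurableT_comp => //.
by apply: measurable_funN; exact: measurable_funM.
Qed.

Lemma integrable_expR_phi d (T : measurableType d) (R : realType)
    (mu : {measure set T -> \bar R}) (phi : T -> R) (z : R) :
  measurable_fun [set: T] phi ->
  (forall A : set R, measurable A -> mu (phi @^-1` A) = lebesgue_measure A) ->
  0 < z ->
  mu.-integrable (phi @^-1` `]0, +oo[) (fun t => (expR (- (z * phi t)))%:E) /\
  \int[mu]_(t in phi @^-1` `]0, +oo[) expR (- (z * phi t)) = z^-1.
Proof.
move=> mphi muphi z0.
have E : (\int[mu]_(t in phi @^-1` `]0%R, +oo[) (expR (- (z * phi t)))%:E = z^-1%:E)%E.
  rewrite -(integral_expR_mulN z0).
  rewrite -(@ge0_integral_phi _ _ _ mu phi _ (fun s => (expR (- (z * s)))%:E))//.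
  - apply/measurable_EFinP; apply: measurableT_comp => //.
    by apply: measurable_funN; exact: measurable_funM.
split; last by rewrite /Rintegral E.
apply/integrableP; split.
  by apply/measurable_EFinP; exact: measurable_fun_expR_phi.
under eq_integral do rewrite gee0_abs ?lee_fin ?expR_ge0//.
by rewrite E ltry.
Qed.

Lemma integrable_dist_powR_phi d (T : measurableType d) (R : realType)
    (mu : {measure set T -> \bar R}) (phi : T -> R) (x alpha : R) (D : set T) :
  measurable_fun [set: T] phi ->
  (forall A : set R, measurable A -> mu (phi @^-1` A) = lebesgue_measure A) ->
  0 < alpha -> measurable D ->
  mu.-integrable D (fun t =>
    ((fun s => (`|s - x| `^ alpha / `|s - x|)%:E) \_ `]x - 1, x + 1[) (phi t)).
Proof.
move=> mphi muphi a0 mD.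
set h := (X in X \_ _); set B := (X in _ \_ X).
have mB : measurable B by exact: measurable_itv.
have mh : measurable_fun [set: R] (h \_ B).
  apply/(measurable_restrict _ _) => //; apply: measurable_funTS.
  by apply/measurable_EFinP; exact: measurable_dist_powR.
have h0 s : (0 <= (h \_ B) s)%E.
  by rewrite patchE; case: ifPn => // _; rewrite lee_fin divr_ge0 ?powR_ge0.
apply: (@integrableS _ _ _ mu setT) => //.
apply/integrableP; split; first exact: measurableT_comp.
under eq_integral do rewrite gee0_abs//.
rewrite -(preimage_setT phi) ge0_integral_phi//.
by rewrite -integral_mkcond; exact: integral_dist_powR_lty.
Qed.

(** * The error integral and its limit *)

Lemma Rintegral_sum_nat d (T : measurableType d) (R : realType)
    (mu : {measure set T -> \bar R}) (D : set T) (h : nat -> T -> R) n :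
  measurable D -> (forall k, mu.-integrable D (EFin \o h k)) ->
  \int[mu]_(t in D) (\sum_(0 <= k < n) h k t) =
  \sum_(0 <= k < n) \int[mu]_(t in D) h k t.
Proof.
move=> mD ih; rewrite /Rintegral.
under eq_integral do rewrite -sumEFin.
rewrite integral_sum// -sum_fine// => k _.
by apply: integrable_fin_num => //; exact: ih.
Qed.

(** The kernel is a finite combination of exponentials with positive rates, so everything is
    integrable term by term. The constant l moves under the integral because the kernel has mass
    1. *)
Lemma gs_error_integral d (T : measurableType d) (R : realType)
    (mu : {measure set T -> \bar R}) (phi f : T -> R) (c l : R) n :
  measurable_fun [set: T] phi ->
  (forall A : set R, measurable A -> mu (phi @^-1` A) = lebesgue_measure A) ->
  (forall z : R, 0 < z -> mu.-integrable (phi @^-1` `]0, +oo[)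
     (fun t => (expR (- (z * phi t)) * f t)%:E)) ->
  0 < c -> (0 < n)%N ->
  let err t := gs_kernel n (4 * expR (- (c * phi t)) * (1 - expR (- (c * phi t))))
     * (f t - l) in
  mu.-integrable (phi @^-1` `]0, +oo[) (EFin \o err) /\
  c * (\sum_(1 <= k < n.*2.+1) gs_coef R n k *
       \int[mu]_(t in phi @^-1` `]0, +oo[) (expR (- (k%:R * c * phi t)) * f t)) - l =
  c * \int[mu]_(t in phi @^-1` `]0, +oo[) err t.
Proof.
move=> mphi muphi fint c0 n0; set D := _ @^-1` _.
have mD : measurable D by apply: measurable_preimage_phi => //; exact: measurable_itv.
move=> err.
pose e k t := expR (- (k.+1%:R * c * phi t)).
have kc0 k : 0 < k.+1%:R * c by rewrite mulr_gt0.
have ie k := integrable_expR_phi mphi muphi (kc0 k).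
pose h k t := gs_coef R n k.+1 * (e k t * f t - l * e k t).
have errE : err = fun t => \sum_(0 <= k < n.*2) h k t.
  apply/funext => t; rewrite /err -sum_gs_coef_expn mulr_suml big_add1/=.
  apply: eq_bigr => k _; rewrite -expRM_natl mulrN mulrA /h /e.
  by ring.
have i1 k : mu.-integrable D (EFin \o (fun t => e k t * f t)) by exact: fint.
have i2 k : mu.-integrable D (EFin \o (fun t => l * e k t)).
  have := integrableZl mD l (ie k).1; exact: eq_integrable.
have i3 k : mu.-integrable D (EFin \o (fun t => e k t * f t - l * e k t)).
  have := integrableB mD (i1 k) (i2 k); exact: eq_integrable.
have ih k : mu.-integrable D (EFin \o h k).
  have := integrableZl mD (gs_coef R n k.+1) (i3 k); exact: eq_integrable.
have ierr : mu.-integrable D (EFin \o err).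
  rewrite errE; have := integrable_sum mD (index_iota 0 n.*2) (fun k (_ : xpredT k) => ih k).
  by apply: eq_integrable => // t _ /=; rewrite sumEFin.
split => //.
rewrite errE Rintegral_sum_nat//.
have Ih k : \int[mu]_(t in D) h k t = gs_coef R n k.+1 *
    (\int[mu]_(t in D) (e k t * f t) - l * (k.+1%:R * c)^-1).
  rewrite /h RintegralZl// RintegralB// RintegralZl//; last exact: (ie k).1.
  by rewrite (ie k).2.
under [in RHS]eq_bigr do rewrite Ih mulrBr.
rewrite sumrB mulrBr big_add1/=; congr (_ - _).
transitivity (l * \sum_(1 <= k < n.*2.+1) gs_coef R n k / k%:R).
  by rewrite sum_gs_coef_inv// mulr1.
rewrite big_add1/= !mulr_sumr; apply: eq_bigr => k _.
by field; rewrite lt0r_neq0//= addrC natr1 pnatr_eq0.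
Qed.

Lemma cvg_gs_phi d (T : measurableType d) (R : realType)
    (mu : {measure set T -> \bar R}) (phi f : T -> R) (x l alpha K delta : R) :
  measurable_fun [set: T] phi ->
  (forall A : set R, measurable A -> mu (phi @^-1` A) = lebesgue_measure A) ->
  (forall z : R, 0 < z -> mu.-integrable (phi @^-1` `]0, +oo[)
     (fun t => (expR (- (z * phi t)) * f t)%:E)) ->
  0 < x -> 0 < alpha -> 0 < K -> 0 < delta ->
  (forall t, 0 < phi t -> `|phi t - x| < delta ->
     `|f t - l| <= K * `|phi t - x| `^ alpha) ->
  (fun n => ln 2 / x * (\sum_(1 <= k < n.*2.+1) gs_coef R n k *
     \int[mu]_(t in phi @^-1` `]0, +oo[) (expR (- (k%:R * (ln 2 / x) * phi t)) * f t)))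
    @ \oo --> l.
Proof.
move=> mphi muphi fint x0 a0 K0 d0 fhol; set D := _ @^-1` _.
have mD : measurable D by apply: measurable_preimage_phi => //; exact: measurable_itv.
set c := ln 2 / x.
have c0 : 0 < c by rewrite divr_gt0// ln_gt0// ltr1n.
have cx : c * x = ln 2 by rewrite divfK// lt0r_neq0.
clearbody c.
have D0 t : D t -> 0 < phi t by rewrite /D/= in_itv/= andbT.
pose kern n t : R := gs_kernel n (4 * expR (- (c * phi t)) * (1 - expR (- (c * phi t)))).
pose err n t := kern n t * (f t - l).
have ierr n : (0 < n)%N -> mu.-integrable D (EFin \o err n).
  by move=> n0; have [] := @gs_error_integral _ _ _ mu phi f c l n mphi muphi fint c0 n0.
have errE n : (0 < n)%N -> c * (\sum_(1 <= k < n.*2.+1) gs_coef R n k *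
     \int[mu]_(t in D) (expR (- (k%:R * c * phi t)) * f t)) - l =
     c * \int[mu]_(t in D) err n t.
  by move=> n0; have [] := @gs_error_integral _ _ _ mu phi f c l n mphi muphi fint c0 n0.
(* The kernel bounds hold only for n > 20, so the sequence is shifted by 21. *)
suff cerr : \int[mu]_(t in D) err (n + 21)%N t @[n --> \oo] --> (0 : R).
  rewrite -(cvg_shiftn 21).
  have : l + c * \int[mu]_(t in D) err (n + 21)%N t @[n --> \oo] --> l + c * 0.
    by apply: cvgD; [exact: cvg_cst|apply: cvgM => //; exact: cvg_cst].
  rewrite mulr0 addr0; apply: cvg_trans; apply: near_eq_cvg; apply: nearW => n /=.
  by rewrite -errE ?addn_gt0 ?orbT// addrC subrK.
have [C C0 kern_le] := gs_kernel_expR_le c0 cx.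
(* Within delta the Hoelder bound applies; within 1 the singular majorant is integrable and 1 +
   1/(c|u|) <= (1 + 1/c)/|u|. *)
pose rho := Num.min delta 1.
have rho0 : 0 < rho by rewrite lt_min d0 ltr01.
pose C1 := C * (1 + c^-1) * K.
pose C2 := C * (1 + (c * rho)^-1).
have C10 : 0 <= C1 by rewrite !mulr_ge0 ?addr_ge0 ?invr_ge0 ?(ltW c0) ?(ltW K0).
have C20 : 0 <= C2 by rewrite mulr_ge0// addr_ge0// invr_ge0 mulr_ge0// ltW.
pose near_part t : \bar R :=
  ((fun s => (`|s - x| `^ alpha / `|s - x|)%:E) \_ `]x - 1, x + 1[) (phi t).
(* The first summand dominates within rho of x. Farther out 1/|c(phi t - x)| is bounded, and the
   second summand is integrable because the Laplace integrals converge at the rate c/2. *)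
pose g t : \bar R := (C1%:E * near_part t
  + C2%:E * (`|(expR (- (c / 2 * phi t)) * f t)%:E| + `|l|%:E * (expR (- (c / 2 * phi t)))%:E))%E.
have near0 t : (0 <= near_part t)%E.
  by rewrite /near_part patchE; case: ifPn => // _; rewrite lee_fin divr_ge0 ?powR_ge0.
have c20 : 0 < c / 2 by rewrite divr_gt0.
have ig : mu.-integrable D g.
  apply: integrableD => //.
    by apply: integrableZl => //; exact: integrable_dist_powR_phi.
  apply: integrableZl => //; apply: integrableD => //.
    by apply: integrable_abse; exact: fint.
  by apply: integrableZl => //; exact: (integrable_expR_phi mphi muphi c20).1.
have domin n t : (20 < n)%N -> D t -> (`|(err n t)%:E| <= g t)%E.
  move=> n20 /D0 t0; rewrite abse_EFin /err normrM.
  have tail0 : (0 <= `|(expR (- (c / 2 * phi t)) * f t)%:E|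
      + `|l|%:E * (expR (- (c / 2 * phi t)))%:E)%E.
    by rewrite adde_ge0// mule_ge0// lee_fin// expR_ge0.
  have [tx|tx] := eqVneq (phi t) x.
    have -> : `|f t - l| = 0.
      apply/eqP; rewrite eq_le normr_ge0 andbT.
      have := fhol t t0; rewrite tx subrr normr0 powR0 ?lt0r_neq0// mulr0; exact.
    by rewrite mulr0 /g adde_ge0// mule_ge0// lee_fin.
  have u0 : 0 < `|phi t - x| by rewrite normr_gt0 subr_eq0.
  have kt := kern_le n (phi t) n20 t0 tx; rewrite -/(kern n t) in kt.
  have E1 : expR (- (c / 2 * phi t)) <= 1.
    by rewrite -[leRHS]expR0 ler_expR oppr_le0 mulr_ge0 ?(ltW c20) ?(ltW t0).
  have cu : `|c * (phi t - x)| = c * `|phi t - x| by rewrite normrM gtr0_norm.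
  have [tr|tr] := ltP `|phi t - x| rho.
    move: tr; rewrite lt_min => /andP[td t1].
    rewrite /g -[X in (X <= _)%E]adde0; apply: leeD; last by rewrite mule_ge0.
    have -> : near_part t = (`|phi t - x| `^ alpha / `|phi t - x|)%:E.
      rewrite /near_part patchE mem_set//= in_itv/=; move: t1; rewrite ltr_norml; lra.
    rewrite -EFinM lee_fin.
    have k2 : `|kern n t| <= C * (1 + c^-1) / `|phi t - x|.
      rewrite (le_trans kt)// -[leLHS]mulrA -[leRHS]mulrA ler_wpM2l//.
      rewrite -[leRHS]mul1r; apply: ler_pM; rewrite ?expR_ge0 ?addr_ge0 ?invr_ge0//.
      rewrite cu invfM mulrDl mul1r lerD2r -invr1 lef_pV2 ?posrE//; exact: ltW.
    have -> : C1 * (`|phi t - x| `^ alpha / `|phi t - x|) =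
       C * (1 + c^-1) / `|phi t - x| * (K * `|phi t - x| `^ alpha) by rewrite /C1; ring.
    by apply: ler_pM => //; exact: fhol.
  rewrite /g -[X in (X <= _)%E]add0e; apply: leeD; first by rewrite mule_ge0 ?lee_fin.
  rewrite abse_EFin -EFinM lee_fin normrM (ger0_norm (expR_ge0 _)).
  have -> : C2 * (expR (- (c / 2 * phi t)) * `|f t| + `|l| * expR (- (c / 2 * phi t)))
    = C2 * expR (- (c / 2 * phi t)) * (`|f t| + `|l|) by ring.
  apply: ler_pM => //; last exact: ler_normB.
  rewrite (le_trans kt)// /C2 mulrAC ler_wpM2r ?expR_ge0// ler_wpM2l// lerD2l.
  by rewrite cu lef_pV2 ?posrE ?mulr_gt0// ler_pM2l.
have merr n : measurable_fun D (EFin \o err (n + 21)%N).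
  by apply: (measurable_int mu); apply: ierr; rewrite addn_gt0 orbT.
have err_cvg t : D t -> (EFin \o err (n + 21)%N) t @[n --> \oo] --> (0%E : \bar R).
  move=> /D0 t0; apply/cvg_EFin; first exact: nearW.
  have [tx|tx] := eqVneq (phi t) x.
    have fl : f t - l = 0.
      apply/eqP; rewrite -normr_eq0 eq_le normr_ge0 andbT.
      have := fhol t t0; rewrite tx subrr normr0 powR0 ?lt0r_neq0// mulr0; exact.
    rewrite (_ : _ \o _ = cst 0); first exact: cvg_cst.
    by apply/funext => n /=; rewrite /err fl mulr0.
  have kc := @cvg_gs_kernel_expR R c x (phi t) c0 cx t0 tx.
  rewrite -(cvg_shiftn 21) in kc.
  have : err (n + 21)%N t @[n --> \oo] --> 0 * (f t - l).
    by apply: cvgM => //; exact: cvg_cst.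
  by rewrite mul0r.
have n21 n : (20 < n + 21)%N by rewrite addnS ltnS leq_addl.
have [_ _ cv] := @dominated_convergence _ _ _ mu D mD
  (fun n => EFin \o err (n + 21)%N) (cst 0%E) g merr (measurable_cst _)
  (aeW _ err_cvg) ig (aeW _ (fun t n Dt => domin (n + 21)%N t (n21 n) Dt)).
by rewrite integral0 in cv; exact: (fine_cvg cv).
Qed.

Theorem corollary1 (R : realType) (f : R -> R)
    (f_locint : locally_integrable_pos f)
    (f_laplace : forall z : R, 0 < z -> laplace_exists f z)
    (x : R) (x_gt0 : 0 < x)
    (alpha : R) (alpha_gt0 : 0 < alpha)
    (f_holder : exists K delta : R, [/\ 0 < K, 0 < delta &
       forall v : R, `|v| < delta -> 0 < x + v ->
         `|f (x + v) - f x| <= K * `|v| `^ alpha]) :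
  (fun n : nat => gaver_stehfest f n x) @ \oo --> f x.
Proof.
have [K [delta [K0 d0 fK]]] := f_holder.
rewrite /gaver_stehfest /laplace.
under eq_fun => n do under eq_bigr => k _ do
  (under eq_Rintegral => t _ do rewrite -(mulrA k%:R)).
apply: (@cvg_gs_phi _ _ R (leb R) (fun t => t) f x (f x) alpha K delta) => //.
(* The identity is measurable from the completed to the Borel sigma-algebra because Borel sets are
   Caratheodory measurable. *)
- by move=> _ A mA; rewrite setTI; exact: sub_caratheodory.
- move=> t t0 tx; have := fK (t - x) tx; rewrite addrC subrK; exact.
Qed.
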